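(* The following two statements are equivalent. (1) For every separable Hilbert space $H$, every sequence of scalars $(m_j)_{j=1}^\infty$ and all sequences $(x_j)_{j=1}^\infty,(f_j)_{j=1}^\infty$ in $H$ such that the series $\sum_{j=1}^\infty \varepsilon_j m_j\langle x,f_j\rangle x_j$ converges for all $x\in H$ and all scalars $\varepsilon_j$ with $|\varepsilon_j|=1$, there exist sequences of scalars $(c_j)_{j=1}^\infty$ and $(d_j)_{j=1}^\infty$ with $c_j\overline{d_j}=m_j$ for all $j\in\mathbb{N}$ such that both $(c_jx_j)_{j=1}^\infty$ and $(d_jf_j)_{j=1}^\infty$ are Bessel sequences. (2) There exists a universal constant $\kappa>0$ such that the following holds: for every $C>0$, every finite dimensional Hilbert space $H$, every $n\in\mathbb{N}$, every sequence of scalars $(m_j)_{j=1}^n$ and all sequences $(x_j)_{j=1}^n,(f_j)_{j=1}^n$ in $H$ satisfying $$\Big\|\sum_{j=1}^n\varepsilon_j m_j\langle x,f_j\rangle x_j\Big\|\leq C\|x\|\qquad\text{for all }x\in H\text{ and all scalars }\varepsilon_j\text{ with }|\varepsilon_j|=1,$$ there exist sequences of scalars $(c_j)_{j=1}^n$ and $(d_j)_{j=1}^n$ with $c_j\overline{d_j}=m_j$ for all $1\leq j\leq n$ such that both $(c_jx_j)_{j=1}^n$ and $(d_jf_j)_{j=1}^n$ have Bessel bound $C\kappa$.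
   Context: A sequence $(y_j)_{j\in J}$ in a Hilbert space $H$ has Bessel bound $B$ if $\sum_{j\in J}|\langle x,y_j\rangle|^2\leq B\|x\|^2$ for all $x\in H$; it is Bessel if it has some finite Bessel bound. *)

(* Defs.v *)
From HB Require Import structures.
From mathcomp Require Import all_boot all_order all_algebra.
From mathcomp Require Import reals.
From mathcomp Require Import complex.

Set Implicit Arguments.
Unset Strict Implicit.
Unset Printing Implicit Defensive.
Import Order.TTheory GRing.Theory Num.Theory.
Local Open Scope ring_scope.

(* Scalars are the complex numbers R[i] over a real field R : realType.
   A (complex) Hilbert space is modelled as a complex vector space V
   (an lmodType over R[i]) together with an inner product ip that is linear
   in the first argument and conjugate-linear in the second, such that V is
   complete for the induced norm. *)
Definition cabs (R : realType) (z : R[i]) : R := ComplexField.Normc.normc z.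

Section Hilbert.
Variable R : realType.
Local Notation C := R[i].
Variable V : lmodType C.
Variable ip : V -> V -> C.

Definition is_inner_product :=
  [/\ forall (a : C) (x y z : V), ip (a *: x + y) z = a * ip x z + ip y z,
      forall x y : V, ip y x = conjc (ip x y),
      forall x : V, 0 <= ip x x
    & forall x : V, ip x x = 0 -> x = 0].

Definition hnorm (x : V) : R := Num.sqrt (cabs (ip x x)).

Definition hcvg_to (u : nat -> V) (s : V) :=
  forall e : R, 0 < e -> exists N : nat, forall n : nat, (N <= n)%N ->
    hnorm (u n - s) < e.

Definition hcauchy (u : nat -> V) :=
  forall e : R, 0 < e -> exists N : nat, forall m n : nat,
    (N <= m)%N -> (N <= n)%N -> hnorm (u m - u n) < e.

Definition hcomplete := forall u : nat -> V, hcauchy u -> exists s, hcvg_to u s.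

Definition is_hilbert := is_inner_product /\ hcomplete.

Definition hseparable :=
  exists d : nat -> V, forall (x : V) (e : R), 0 < e ->
    exists k : nat, hnorm (x - d k) < e.

Definition hfinite_dim :=
  exists (n : nat) (b : 'I_n -> V), forall x : V,
    exists a : 'I_n -> C, x = \sum_(i < n) a i *: b i.

Definition hseries_converges (u : nat -> V) :=
  exists s : V, hcvg_to (fun N => \sum_(j < N) u j) s.

(* (y_j)_{j in N} has Bessel bound B:
   sum_j |<x,y_j>|^2 <= B ||x||^2 for all x (the series has nonnegative
   terms, so this is the bound on all partial sums). *)
Definition has_bessel_bound (B : R) (y : nat -> V) :=
  forall (x : V) (N : nat),
    \sum_(j < N) cabs (ip x (y j)) ^+ 2 <= B * hnorm x ^+ 2.

Definition is_bessel (y : nat -> V) := exists B : R, has_bessel_bound B y.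

Definition has_bessel_bound_fin (n : nat) (B : R) (y : 'I_n -> V) :=
  forall x : V, \sum_(j < n) cabs (ip x (y j)) ^+ 2 <= B * hnorm x ^+ 2.

End Hilbert.

(* Main.v *)
Require Import Defs.
From HB Require Import structures.
From mathcomp Require Import all_boot all_order all_algebra.
From mathcomp Require Import boolp classical_sets functions filter.
From mathcomp Require Import reals topology normedtype sequences.
From mathcomp Require Import complex.
From mathcomp Require Import ring lra.

Set Implicit Arguments.
Unset Strict Implicit.
Unset Printing Implicit Defensive.
Import Order.TTheory GRing.Theory Num.Theory.
Import numFieldNormedType.Exports.
Local Open Scope classical_set_scope.
Local Open Scope ring_scope.

(* (2) => (1): a gliding hump bounds the signed partial sums at each vector, and
   the uniform boundedness principle turns this into one constant C valid for all
   partial sums and all signs.  Applying (2) to the first N terms, in the span of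
   the vectors involved, gives weights |c_j|^2 and |d_j|^2 with Bessel bound
   C kappa; they are bounded for each fixed j, and their limits along an
   ultrafilter on N keep the bound and the product |m_j|^2.  Indices with x_j = 0
   or f_j = 0 escape this compactness and receive summable weights by hand.

   (1) => (2): if (2) fails, choose for every k a finite system with C = 1 that
   admits no factorization with bound k + 1, and place these systems in mutually
   orthogonal blocks of l^2.  Subset sums of a block are averages of signed sums,
   so the resulting series converges for all signs, and the Bessel bound supplied
   by (1) contradicts the choice of a late block. *)

(** * Complex moduli and inner products *)

Section ComplexModulus.
Variable R : realType.
Implicit Types (z w : R[i]) (r : R).

Lemma cabs_ge0 z : 0 <= cabs z.
Proof. by case: z => a b; apply: sqrtr_ge0. Qed.

Lemma cabs_sqr z : cabs z ^+ 2 = complex.Re z ^+ 2 + complex.Im z ^+ 2.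
Proof. by case: z => a b; rewrite /cabs /= sqr_sqrtr // addr_ge0 ?sqr_ge0. Qed.

Lemma cabs0 : cabs (0 : R[i]) = 0.
Proof. exact: ComplexField.Normc.normc0. Qed.

Lemma cabs1 : cabs (1 : R[i]) = 1.
Proof. exact: ComplexField.Normc.normc1. Qed.

Lemma cabsM z w : cabs (z * w) = cabs z * cabs w.
Proof. exact: ComplexField.Normc.normcM. Qed.

Lemma cabsV z : cabs z^-1 = (cabs z)^-1.
Proof. exact: ComplexField.Normc.normcV. Qed.

Lemma cabsN z : cabs (- z) = cabs z.
Proof. exact: normcN. Qed.

Lemma cabs_eq0 z : (cabs z == 0) = (z == 0).
Proof.
apply/eqP/eqP => [/ComplexField.Normc.eq0_normc //|->]; exact: cabs0.
Qed.

Lemma cabs_real r : cabs r%:C%C = `|r|.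
Proof. by rewrite /cabs /= expr0n /= addr0 sqrtr_sqr. Qed.

Lemma cabs_conj z : cabs (conjc z) = cabs z.
Proof. by case: z => a b; rewrite /cabs /= sqrrN. Qed.

Lemma mul_conjc z : z * conjc z = (cabs z ^+ 2)%:C%C.
Proof.
rewrite cabs_sqr; case: z => a b; apply/eqP.
by rewrite eq_complex /=; apply/andP; split; apply/eqP; ring.
Qed.

Lemma norm_Re_le_cabs (z : R[i]) : `|complex.Re z| <= cabs z.
Proof.
by case: z => p q; rewrite /cabs /= -sqrtr_sqr ler_wsqrtr // lerDl sqr_ge0.
Qed.

Lemma Re_le_cabs z : complex.Re z <= cabs z.
Proof.
by apply: (le_trans (ler_norm _)); apply: norm_Re_le_cabs.
Qed.

Lemma ReD z w : complex.Re (z + w) = complex.Re z + complex.Re w.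
Proof. by case: z w => [a b] [c d]. Qed.

Lemma ImD z w : complex.Im (z + w) = complex.Im z + complex.Im w.
Proof. by case: z w => [a b] [c d]. Qed.

Lemma ReM z w :
  complex.Re (z * w) = complex.Re z * complex.Re w - complex.Im z * complex.Im w.
Proof. by case: z w => [a b] [c d]. Qed.

Lemma ImM z w :
  complex.Im (z * w) = complex.Re z * complex.Im w + complex.Im z * complex.Re w.
Proof. by case: z w => [a b] [c d]. Qed.

Lemma norm_Im_le_cabs (z : R[i]) : `|complex.Im z| <= cabs z.
Proof.
by case: z => p q; rewrite /cabs /= -sqrtr_sqr ler_wsqrtr // lerDr sqr_ge0.
Qed.

Lemma cabs_le_Re_Im z :
  cabs z <= `|complex.Re z| + `|complex.Im z|.
Proof.
rewrite -(ler_pXn2r (n := 2)) ?nnegrE ?addr_ge0 ?cabs_ge0 //.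
rewrite cabs_sqr sqrrD !real_normK ?num_real // -addrA lerD2l lerDr.
by rewrite mulrn_wge0 // mulr_ge0.
Qed.

End ComplexModulus.

(** * Inner product spaces, orthogonal projection and Gram-Schmidt *)

Section InnerProduct.
Variables (R : realType) (V : lmodType R[i]) (ip : V -> V -> R[i]).
Hypothesis ipP : is_inner_product ip.
Local Notation "<| x , y |>" := (ip x y) (format "<| x ,  y |>").
Local Notation "`[ x ]" := (hnorm ip x) (format "`[ x ]").
Implicit Types (x y z : V) (a : R[i]).

Lemma ip_conj x y : <|y, x|> = conjc <|x, y|>.
Proof. by case: ipP. Qed.

Lemma ipDl x y z : <|x + y, z|> = <|x, z|> + <|y, z|>.
Proof. by case: ipP => /(_ 1 x y z) + _ _ _; rewrite scale1r mul1r. Qed.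

Lemma ip0l z : <|0, z|> = 0.
Proof. by have /eqP := ipDl 0 0 z; rewrite addr0 addrC -subr_eq subrr => /eqP. Qed.

Lemma ipZl a x z : <|a *: x, z|> = a * <|x, z|>.
Proof. by case: ipP => /(_ a x 0 z) + _ _ _; rewrite ip0l !addr0. Qed.

Lemma ipDr x y z : <|z, x + y|> = <|z, x|> + <|z, y|>.
Proof. by rewrite ip_conj ipDl rmorphD /= -!ip_conj. Qed.

Lemma ipZr a x z : <|z, a *: x|> = conjc a * <|z, x|>.
Proof. by rewrite ip_conj ipZl rmorphM /= -!ip_conj. Qed.

Lemma ip0r z : <|z, 0|> = 0.
Proof. by rewrite ip_conj ip0l conjc0. Qed.

Lemma ipNl x z : <|- x, z|> = - <|x, z|>.
Proof. by rewrite -scaleN1r ipZl mulN1r. Qed.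

Lemma ipBl x y z : <|x - y, z|> = <|x, z|> - <|y, z|>.
Proof. by rewrite ipDl ipNl. Qed.

Lemma ipNr x z : <|z, - x|> = - <|z, x|>.
Proof. by rewrite ip_conj ipNl rmorphN /= -ip_conj. Qed.

Lemma ipBr x y z : <|z, x - y|> = <|z, x|> - <|z, y|>.
Proof. by rewrite ipDr ipNr. Qed.

Lemma ip_suml (I : Type) (r : seq I) (P : pred I) (F : I -> V) z :
  <|\sum_(i <- r | P i) F i, z|> = \sum_(i <- r | P i) <|F i, z|>.
Proof. exact: (big_morph (ip^~ z) (fun x y => ipDl x y z) (ip0l z)). Qed.

Lemma ip_sumr (I : Type) (r : seq I) (P : pred I) (F : I -> V) z :
  <|z, \sum_(i <- r | P i) F i|> = \sum_(i <- r | P i) <|z, F i|>.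
Proof. exact: (big_morph (ip z) (fun x y => ipDr x y z) (ip0r z)). Qed.

Lemma hnorm_ge0 x : 0 <= `[x].
Proof. exact: sqrtr_ge0. Qed.

Lemma hnorm_sqrE x : `[x] ^+ 2 = cabs <|x, x|>.
Proof. by rewrite sqr_sqrtr // cabs_ge0. Qed.

Lemma ipxx x : <|x, x|> = (`[x] ^+ 2)%:C%C.
Proof.
rewrite hnorm_sqrE; case: ipP => _ _ /(_ x) + _; case: <|x, x|> => a b.
rewrite lecE /= => /andP[/eqP -> a0].
by rewrite /cabs /= expr0n addr0 sqrtr_sqr ger0_norm.
Qed.

Lemma hnorm_sqr_Re x : `[x] ^+ 2 = complex.Re <|x, x|>.
Proof. by rewrite ipxx. Qed.

Lemma hnorm0 : `[0] = 0.
Proof. by rewrite /hnorm ip0l cabs0 sqrtr0. Qed.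

Lemma hnorm_eq0 x : `[x] = 0 -> x = 0.
Proof. by move=> x0; case: ipP => _ _ _; apply; rewrite ipxx x0 expr0n. Qed.

Lemma hnorm_gt0 x : x != 0 -> 0 < `[x].
Proof.
by rewrite lt_def hnorm_ge0 andbT; apply: contra => /eqP/hnorm_eq0 ->.
Qed.

Lemma hnormZ a x : `[a *: x] = cabs a * `[x].
Proof.
rewrite /hnorm ipZl ipZr !cabsM cabs_conj mulrA -expr2 sqrtrM ?sqr_ge0 //.
by rewrite sqrtr_sqr ger0_norm ?cabs_ge0.
Qed.

Lemma hnormN x : `[- x] = `[x].
Proof. by rewrite -scaleN1r hnormZ cabsN cabs1 mul1r. Qed.

Lemma hnormC x y : `[x - y] = `[y - x].
Proof. by rewrite -hnormN opprB. Qed.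

(** Expand the squared norm of [N x - p y] with [N = |y|^2] and [p = <x, y>]: it equals
    [N (N |x|^2 - |p|^2)] and is nonnegative. This multiple of the projection residue avoids
    division by [N]. *)
Lemma cauchy_schwarz x y : cabs <|x, y|> <= `[x] * `[y].
Proof.
have [->|y0] := eqVneq y 0; first by rewrite ip0r cabs0 hnorm0 mulr0.
have N0 := hnorm_gt0 y0.
rewrite -(ler_pXn2r (n := 2)) ?nnegrE ?mulr_ge0 ?cabs_ge0 ?hnorm_ge0 //.
pose p := <|x, y|>; pose N := `[y] ^+ 2.
have : 0 <= `[N%:C%C *: x - p *: y] ^+ 2 by exact: sqr_ge0.
have -> : `[N%:C%C *: x - p *: y] ^+ 2 = N * (N * `[x] ^+ 2 - cabs p ^+ 2).
  apply: complexI; rewrite -ipxx !(ipBl, ipBr) !(ipZl, ipZr) !ipxx.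
  rewrite (ip_conj x y) -/p -/N conjc_real.
  move: (mul_conjc p) (`[x] ^+ 2) N; move: (cabs p ^+ 2) (conjc p) => b q bE X N.
  by rewrite !(rmorphM, rmorphB) /= -bE; ring.
by rewrite pmulr_rge0 ?exprn_gt0 // subr_ge0 exprMn mulrC.
Qed.

Lemma hnormD x y : `[x + y] <= `[x] + `[y].
Proof.
rewrite -(ler_pXn2r (n := 2)) ?nnegrE ?addr_ge0 ?hnorm_ge0 //.
rewrite [in leLHS]hnorm_sqr_Re ipDl !ipDr (ip_conj x y) !ReD.
rewrite -!hnorm_sqr_Re.
have -> : complex.Re (conjc <|x, y|>) = complex.Re <|x, y|> by case: <|x, y|>.
have := Re_le_cabs <|x, y|>; have := cauchy_schwarz x y; nra.
Qed.

Lemma hnormB x y z : `[x - z] <= `[x - y] + `[y - z].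
Proof. by have := hnormD (x - y) (y - z); rewrite addrA subrK. Qed.

Lemma hnorm_sum (I : Type) (r : seq I) (P : pred I) (F : I -> V) :
  `[\sum_(i <- r | P i) F i] <= \sum_(i <- r | P i) `[F i].
Proof.
elim/big_ind2: _ => [|x a y b xa yb|//]; first by rewrite hnorm0.
by apply: (le_trans (hnormD _ _)); apply: lerD.
Qed.

Lemma hnorm_sqrDo x y : <|x, y|> = 0 -> `[x + y] ^+ 2 = `[x] ^+ 2 + `[y] ^+ 2.
Proof.
move=> xy; rewrite !hnorm_sqr_Re ipDl !ipDr (ip_conj x y) xy conjc0.
by rewrite addr0 add0r ReD.
Qed.

Lemma hnorm_sqr_sum (n : nat) (F : nat -> V) :
  (forall i j, (i < n)%N -> (j < n)%N -> i != j -> <|F i, F j|> = 0) ->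
  `[\sum_(i < n) F i] ^+ 2 = \sum_(i < n) `[F i] ^+ 2.
Proof.
elim: n => [|n IH] Fo; first by rewrite !big_ord0 hnorm0 expr0n.
rewrite !big_ord_recr /= hnorm_sqrDo ?IH //.
  by move=> i j ilt jlt; apply: Fo; apply: leqW.
rewrite ip_suml big1 // => i _; apply: Fo => //; first exact: leqW.
by rewrite neq_ltn ltn_ord.
Qed.

(** The family is indexed by all of [nat] with only the first [d] members constrained, so that
    Gram-Schmidt can append a vector without changing the index type. *)
Definition orthonormal (d : nat) (e : nat -> V) :=
  forall i j, (i < d)%N -> (j < d)%N -> <|e i, e j|> = (i == j)%:R.

Definition oproj (d : nat) (e : nat -> V) (v : V) := \sum_(i < d) <|v, e i|> *: e i.

Section Projection.
Variables (d : nat) (e : nat -> V).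
Hypothesis eP : orthonormal d e.

Lemma ip_lincomb (a : nat -> R[i]) j :
  (j < d)%N -> <|\sum_(i < d) a i *: e i, e j|> = a j.
Proof.
move=> jd; rewrite ip_suml (bigD1 (Ordinal jd)) //= big1 => [|i].
  by rewrite ipZl eP // eqxx mulr1 addr0.
by rewrite ipZl -val_eqE /= eP // => /negPf ->; rewrite mulr0.
Qed.

(** Pythagoras: with [p] the projection, [<p, p> = <v, p>], so [v - p] is orthogonal to [p]. *)
Lemma hnorm_sqr_oproj v :
  `[v - oproj d e v] ^+ 2 = `[v] ^+ 2 - \sum_(i < d) cabs <|v, e i|> ^+ 2.
Proof.
pose p := oproj d e v.
have pe j : (j < d)%N -> <|p, e j|> = <|v, e j|>.
  exact: (ip_lincomb (fun j => <|v, e j|>)).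
have pp : <|p, p|> = <|v, p|>.
  by rewrite {2 3}/p !ip_sumr; apply: eq_bigr => i _; rewrite !ipZr pe.
have -> : \sum_(i < d) cabs <|v, e i|> ^+ 2 = `[p] ^+ 2.
  apply: complexI; rewrite -ipxx pp ip_sumr rmorph_sum; apply: eq_bigr => i _.
  by rewrite ipZr mulrC mul_conjc.
have := @hnorm_sqrDo (v - p) p; rewrite subrK => ->; first by rewrite addrK.
by rewrite ipBl pp subrr.
Qed.

Lemma bessel_oproj v : \sum_(i < d) cabs <|v, e i|> ^+ 2 <= `[v] ^+ 2.
Proof. by rewrite -subr_ge0 -hnorm_sqr_oproj sqr_ge0. Qed.

End Projection.

(** Membership in the span is expressed as being fixed by [oproj], the form used later. Induction on
    the list: the residue [w] of the new vector is zero, and the family stays, or it is normalised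
    and appended. *)
Lemma gram_schmidt (s : seq V) :
  exists (d : nat) (e : nat -> V), orthonormal d e /\
    forall v, v \in s -> oproj d e v = v.
Proof.
elim: s => [|v s [d [e [eP es]]]].
  by exists 0%N, (fun=> 0); split.
pose w := v - oproj d e v.
have we j : (j < d)%N -> <|w, e j|> = 0.
  by move=> jd; rewrite ipBl (ip_lincomb eP (fun i => <|v, e i|>)) ?subrr.
have [w0|w0] := eqVneq w 0.
  exists d, e; split=> // u; rewrite inE => /orP[/eqP ->|/es //].
  by move/eqP: w0; rewrite subr_eq0 => /eqP <-.
have wn : (`[w]%:C)%C != 0 :> R[i].
  by rewrite (inj_eq (@complexI R)) gt_eqF ?hnorm_gt0.
pose u := (`[w]%:C)%C^-1 *: w.
pose e' i := if i == d then u else e i.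
have e'E i : (i < d)%N -> e' i = e i by rewrite /e' => /ltn_eqF ->.
have e'd : e' d = u by rewrite /e' eqxx.
have ue j : (j < d)%N -> <|u, e j|> = 0 by move=> jd; rewrite ipZl we ?mulr0.
have uu : <|u, u|> = 1.
  rewrite ipZl ipZr ipxx conjc_inv conjc_real rmorphXn /=.
  by rewrite expr2 mulKf // mulVf.
have op' x : oproj d.+1 e' x = oproj d e x + <|x, u|> *: u.
  rewrite /oproj big_ord_recr /= e'd; congr (_ + _).
  by apply: eq_bigr => i _; rewrite e'E.
exists d.+1, e'; split=> [i j|x].
  rewrite !ltnS leq_eqVlt => /orP[/eqP ->|id]; rewrite leq_eqVlt => /orP[/eqP ->|jd].
  - by rewrite e'd uu eqxx.
  - by rewrite e'd e'E // ue // gtn_eqF.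
  - by rewrite e'd e'E // ip_conj ue // conjc0 ltn_eqF.
  - by rewrite !e'E // eP.
rewrite inE op' => /orP[/eqP ->|xs].
  (* The new direction [u] is orthogonal to the old projection of [v], so the added term of the
     projection is exactly the residue [w]. *)
  have -> : <|v, u|> = (`[w]%:C)%C.
    rewrite -(subrK (oproj d e v) v) -/w ipDl ip_suml big1 ?addr0.
      by rewrite ipZr ipxx conjc_inv conjc_real rmorphXn /= expr2 mulKf.
    by move=> i _; rewrite ipZl (ip_conj u) ue // conjc0 mulr0.
  by rewrite scalerA divff // scale1r /w addrC subrK.
(* Earlier vectors lie in the old span, so they have no component along [u] and stay fixed. *)
have -> : <|x, u|> = 0.
  rewrite -(es _ xs) ip_suml big1 // => i _.
  by rewrite ipZl (ip_conj u) ue // conjc0 mulr0.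
by rewrite scale0r addr0 es.
Qed.

End InnerProduct.

(** * Limits and series *)

Lemma cvg_sum_ord (R : realType) (T : Type) (F : set_system T) (FF : Filter F)
    (n : nat) (f : nat -> T -> R) (l : nat -> R) :
  (forall i, (i < n)%N -> f i x @[x --> F] --> l i) ->
  \sum_(i < n) f i x @[x --> F] --> \sum_(i < n) l i.
Proof.
elim: n => [|n IH] fl.
  under eq_fun do rewrite big_ord0.
  by rewrite big_ord0; apply: cvg_cst.
under eq_fun do rewrite big_ord_recr.
rewrite big_ord_recr /=; apply: cvgD; last exact: fl.
by apply: IH => i ilt; apply: fl; apply: leqW.
Qed.

Lemma cauchy_seq_cvg (R : realType) (u : nat -> R) :
  (forall e, 0 < e -> exists N, forall m n, (N <= m)%N -> (N <= n)%N ->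
     `|u m - u n| < e) -> cvgn u.
Proof.
move=> uC; apply: cauchy_cvg; apply: cauchy_exP => e e0.
have [N uN] := uC e e0; exists (u N); exists N => // n /= Nn.
exact: uN.
Qed.

(** Compactness of [[0, K]] gives a cluster point of the image of [U]. For an ultrafilter it is a
    limit: otherwise the preimage of the complement of some neighbourhood would be in [U],
    contradicting clustering. *)
Lemma ultra_bounded_cvg (R : realType) (U : set_system nat) (u : nat -> R) (n0 : nat) (K : R) :
  UltraFilter U -> \oo `<=` U ->
  (forall n, (n0 <= n)%N -> 0 <= u n <= K) ->
  exists2 l : R, 0 <= l & u n @[n --> U] --> l.
Proof.
move=> UU ooU uK.
have UK : (u n @[n --> U]) [set` `[0, K]].
  by apply: ooU; exists n0 => // n /= /uK; rewrite in_itv.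
have [l [lK lU]] := segment_compact (a := 0) (b := K) _ UK.
exists l; first by move: lK; rewrite /= in_itv /= => /andP[].
move=> A lA; have [//|UA] := in_ultra_setVsetC (u @^-1` A) UU.
have [r [nr ra]] : (~` A) `&` A !=set0 by apply: lU.
by case: nr.
Qed.

Lemma sum_half_pow (R : realType) (N : nat) : \sum_(j < N) (2^-1 : R) ^+ j <= 2.
Proof.
suff -> : \sum_(j < N) (2^-1 : R) ^+ j = 2 - 2 * 2^-1 ^+ N.
  by rewrite gerBl mulr_ge0 ?exprn_ge0 ?invr_ge0.
elim: N => [|N IH]; first by rewrite big_ord0 expr0 mulr1 subrr.
by rewrite big_ord_recr /= IH exprS; field.
Qed.

(** * Complex limits and square-summable sequences *)

Section ComplexSeries.
Variable R : realType.
Implicit Types (u v : nat -> R[i]) (s t z : R[i]).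

Definition cvgc u z :=
  (complex.Re (u n) @[n --> \oo] --> complex.Re z) /\
  (complex.Im (u n) @[n --> \oo] --> complex.Im z).

Lemma cvgc_unique u z w : cvgc u z -> cvgc u w -> z = w.
Proof.
move=> [uz vz] [uw vw]; apply/eqP; rewrite eq_complex.
by rewrite (norm_cvg_unique uz uw) (norm_cvg_unique vz vw) !eqxx.
Qed.

Lemma cvgcD u v z w : cvgc u z -> cvgc v w -> cvgc (fun n => u n + v n) (z + w).
Proof.
move=> [uz vz] [uw vw]; split.
  by under eq_fun do rewrite ReD; rewrite ReD; apply: cvgD.
by under eq_fun do rewrite ImD; rewrite ImD; apply: cvgD.
Qed.

Lemma cvgcM z u w : cvgc u w -> cvgc (fun n => z * u n) (z * w).
Proof.
move=> [uw vw]; split.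
  under eq_fun do rewrite ReM.
  by rewrite ReM; apply: cvgB; apply: cvgM => //; apply: cvg_cst.
under eq_fun do rewrite ImM.
by rewrite ImM; apply: cvgD; apply: cvgM => //; apply: cvg_cst.
Qed.

Lemma cvgc_conj u w : cvgc u w -> cvgc (fun n => conjc (u n)) (conjc w).
Proof.
have ReJ z : complex.Re (conjc z) = complex.Re z by case: z.
have ImJ z : complex.Im (conjc z) = - complex.Im z by case: z.
move=> [uw vw]; split.
  by under eq_fun do rewrite ReJ; rewrite ReJ.
by under eq_fun do rewrite ImJ; rewrite ImJ; apply: cvgN.
Qed.

Lemma cvgc_real (r : nat -> R) (l : R) :
  r n @[n --> \oo] --> l -> cvgc (fun n => (r n)%:C%C) l%:C%C.
Proof. by move=> rl; split=> //=; apply: cvg_cst. Qed.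

Lemma cvgc_near_cst u z (N : nat) : (forall n, (N <= n)%N -> u n = z) -> cvgc u z.
Proof.
by move=> uz; split; apply/cvgrPdist_lt => e e0; exists N => // n /= Nn;
  rewrite (uz _ Nn) subrr normr0.
Qed.

Definition sqsum (a : nat -> R[i]) (n : nat) : R := \sum_(i < n) cabs (a i) ^+ 2.

Definition sqsummable a := exists B, forall n, sqsum a n <= B.

Lemma sqsum_nd a : {homo sqsum a : n m / (n <= m)%N >-> n <= m}.
Proof.
move=> n m nm; rewrite /sqsum -(subnKC nm) big_split_ord /= lerDl.
by apply: sumr_ge0 => i _; apply: sqr_ge0.
Qed.

Lemma sqsum_cvg a : sqsummable a -> cvgn (sqsum a).
Proof.
move=> [B aB]; apply: nondecreasing_is_cvgn; first exact: sqsum_nd.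
by exists B => _ [n _ <-].
Qed.

Lemma cabs_sqrD z w : cabs (z + w) ^+ 2 <= 2 * cabs z ^+ 2 + 2 * cabs w ^+ 2.
Proof.
rewrite !cabs_sqr ReD ImD.
by have := sqr_ge0 (complex.Re z - complex.Re w);
  have := sqr_ge0 (complex.Im z - complex.Im w); nra.
Qed.

Lemma sqsummableD a b :
  sqsummable a -> sqsummable b -> sqsummable (fun i => a i + b i).
Proof.
move=> [A aA] [B bB]; exists (2 * A + 2 * B) => n.
apply: (@le_trans _ _ (2 * sqsum a n + 2 * sqsum b n)).
  rewrite /sqsum !mulr_sumr -big_split; apply: ler_sum => i _.
  exact: cabs_sqrD.
by apply: lerD; apply: ler_wpM2l.
Qed.

Lemma sqsummableZ z a : sqsummable a -> sqsummable (fun i => z * a i).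
Proof.
move=> [A aA]; exists (cabs z ^+ 2 * A) => n.
rewrite (_ : sqsum _ _ = cabs z ^+ 2 * sqsum a n); last first.
  by rewrite /sqsum mulr_sumr; apply: eq_bigr => i _; rewrite cabsM exprMn.
by apply: ler_wpM2l; rewrite ?sqr_ge0.
Qed.

(* Polarisation: [4 Re (z w^* ) = |z + w|^2 - |z - w|^2], and [Im z = Re (-i z)]. *)
Lemma sqsummable_ip_cvg a b : sqsummable a -> sqsummable b ->
  exists s, cvgc (fun n => \sum_(i < n) a i * conjc (b i)) s.
Proof.
move=> sa sb.
have ReSum c : sqsummable c ->
    cvgn (fun n => complex.Re (\sum_(i < n) c i * conjc (b i))).
  move=> sc.
  have E n : complex.Re (\sum_(i < n) c i * conjc (b i)) =
      4^-1 * (sqsum (fun i => c i + b i) n - sqsum (fun i => c i + -1 * b i) n).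
    rewrite /sqsum -sumrB mulr_sumr.
    rewrite (big_morph (@complex.Re R) (@ReD R) (erefl _)).
    apply: eq_bigr => i _; rewrite !cabs_sqr !ReD !ImD mulN1r.
    by case: (c i) (b i) => [p q] [r s] /=; field.
  under eq_fun do rewrite E.
  apply: is_cvgMr; apply: is_cvgB; apply: sqsum_cvg; apply: sqsummableD => //.
  exact: sqsummableZ.
pose s := complex.Complex
  (limn (fun n => complex.Re (\sum_(i < n) a i * conjc (b i))))
  (limn (fun n => complex.Re (\sum_(i < n) (- 'i%C * a i) * conjc (b i)))).
exists s; split; first exact: ReSum.
rewrite (_ : (fun n => _) =
  fun n => complex.Re (\sum_(i < n) (- 'i%C * a i) * conjc (b i))).
  exact: (ReSum _ (sqsummableZ _ sa)).
apply/funext => n; rewrite (big_morph (@complex.Re R) (@ReD R) (erefl _)).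
rewrite (big_morph (@complex.Im R) (@ImD R) (erefl _)).
apply: eq_bigr => i _; case: (a i) (b i) => [p q] [r t] /=; ring.
Qed.

End ComplexSeries.

(** * The space of square-summable sequences supported in D *)

Section EllTwo.
Variables (R : realType) (D : pred nat).

(** The support condition lets one construction serve twice: an initial segment [D] gives the
    finite-dimensional models, [predT] the full separable space. *)
Definition l2_pred : {pred nat -> R[i]} := fun a =>
  `[< sqsummable a /\ forall i, ~~ D i -> a i = 0 >].

Lemma l2_predP a :
  reflect (sqsummable a /\ forall i, ~~ D i -> a i = 0) (a \in l2_pred).
Proof. exact: asboolP. Qed.

Lemma l2_submod_closed : submod_closed l2_pred.
Proof.
split.
  apply/l2_predP; split=> //; exists 0 => n.
  by rewrite /sqsum big1 // => i _; rewrite cabs0 expr0n.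
move=> z a b /l2_predP[sa Da] /l2_predP[sb Db]; apply/l2_predP; split.
  exact: (sqsummableD (sqsummableZ z sa) sb).
by move=> i Di; rewrite !fctE /= Da // Db // scaler0 addr0.
Qed.

HB.instance Definition _ := GRing.isSubmodClosed.Build _ _ l2_pred l2_submod_closed.

Record l2 := L2 { l2val :> nat -> R[i]; l2valP : l2val \in l2_pred }.

HB.instance Definition _ := [isSub for l2val].
HB.instance Definition _ := [Choice of l2 by <:].
HB.instance Definition _ := [SubChoice_isSubLmodule of l2 by <:].

End EllTwo.

Section EllTwoHilbert.
Variables (R : realType) (D : pred nat).
Local Notation H := (l2 R D).
Implicit Types (a b : H) (z : R[i]).

Lemma l2_sqsummable a : sqsummable a.
Proof. by have /l2_predP[] := l2valP a. Qed.

Lemma l2_supp a i : ~~ D i -> a i = 0.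
Proof. by have /l2_predP[_] := l2valP a; apply. Qed.

Definition l2ip a b : R[i] :=
  projT1 (cid (sqsummable_ip_cvg (l2_sqsummable a) (l2_sqsummable b))).

Lemma l2ip_cvg a b : cvgc (fun n => \sum_(i < n) a i * conjc (b i)) (l2ip a b).
Proof. by rewrite /l2ip; case: cid. Qed.

Lemma l2ip_eq a b s :
  cvgc (fun n => \sum_(i < n) a i * conjc (b i)) s -> l2ip a b = s.
Proof. exact: cvgc_unique (l2ip_cvg a b). Qed.

Lemma l2D a b i : (a + b) i = a i + b i.
Proof. by []. Qed.

Lemma l2B a b i : (a - b) i = a i - b i.
Proof. by []. Qed.

Lemma l2Z z a i : (z *: a) i = z * a i.
Proof. by []. Qed.

Lemma l2ipxx a : l2ip a a = (limn (sqsum a))%:C%C.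
Proof.
apply: l2ip_eq.
rewrite (_ : (fun n => _) = fun n => (sqsum a n)%:C%C).
  by apply: cvgc_real; apply: sqsum_cvg; apply: l2_sqsummable.
apply/funext => n; rewrite /sqsum rmorph_sum; apply: eq_bigr => i _.
exact: mul_conjc.
Qed.

Lemma l2_sqsum_le_lim a n : sqsum a n <= limn (sqsum a).
Proof.
apply: nondecreasing_cvgn_le; first exact: sqsum_nd.
by apply: sqsum_cvg; apply: l2_sqsummable.
Qed.

Lemma l2ip_inner : is_inner_product l2ip.
Proof.
split=> [z a b c|a b|a|a].
- apply: l2ip_eq.
  rewrite (_ : (fun n => _) = fun n => z * (\sum_(i < n) a i * conjc (c i)) +
      \sum_(i < n) b i * conjc (c i)).
    by apply: cvgcD; [apply: cvgcM|]; apply: l2ip_cvg.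
  apply/funext => n; rewrite mulr_sumr -big_split; apply: eq_bigr => i _.
  by rewrite l2D l2Z mulrDl mulrA.
- apply: l2ip_eq.
  rewrite (_ : (fun n => _) = fun n => conjc (\sum_(i < n) a i * conjc (b i))).
    by apply: cvgc_conj; apply: l2ip_cvg.
  apply/funext => n; rewrite rmorph_sum; apply: eq_bigr => i _ /=.
  by rewrite rmorphM /= conjcK mulrC.
- rewrite l2ipxx ler0c; apply: le_trans (l2_sqsum_le_lim a 0).
  by rewrite /sqsum big_ord0.
- rewrite l2ipxx => -[a0]; apply/val_inj/funext => i /=.
  have := l2_sqsum_le_lim a i.+1; rewrite a0 /sqsum big_ord_recr /= => ai.
  apply/eqP; rewrite -cabs_eq0 -sqrf_eq0 eq_le sqr_ge0 andbT.
  apply: le_trans ai; rewrite lerDr; apply: sumr_ge0 => j _; exact: sqr_ge0.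
Qed.

Local Notation "`[ x ]" := (hnorm l2ip x) (format "`[ x ]").

Lemma l2_hnorm_sqr a : `[a] ^+ 2 = limn (sqsum a).
Proof. by rewrite (hnorm_sqr_Re l2ip_inner) l2ipxx. Qed.

Lemma sqsum_le_hnorm a n : sqsum a n <= `[a] ^+ 2.
Proof. by rewrite l2_hnorm_sqr l2_sqsum_le_lim. Qed.

Lemma hnorm_le_sqsum a (B : R) : (forall n, sqsum a n <= B) -> `[a] ^+ 2 <= B.
Proof.
move=> aB; rewrite l2_hnorm_sqr; apply: limr_le.
  by apply: sqsum_cvg; apply: l2_sqsummable.
exact: nearW.
Qed.

Lemma coord_le_hnorm a i : cabs (a i) <= `[a].
Proof.
rewrite -(ler_pXn2r (n := 2)) ?nnegrE ?cabs_ge0 ?hnorm_ge0 //.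
apply: le_trans (sqsum_le_hnorm a i.+1); rewrite /sqsum big_ord_recr /= lerDr.
by apply: sumr_ge0 => j _; apply: sqr_ge0.
Qed.

Lemma l2_complete : hcomplete l2ip.
Proof.
move=> u uC.
have uCi i e : 0 < e -> exists N, forall m n, (N <= m)%N -> (N <= n)%N ->
    cabs (u m i - u n i) < e.
  move=> /uC[N uN]; exists N => m n Nm Nn.
  by apply: le_lt_trans (uN _ _ Nm Nn); rewrite -l2B coord_le_hnorm.
pose s i := complex.Complex (limn (fun n => complex.Re (u n i)))
                            (limn (fun n => complex.Im (u n i))).
have us i : cvgc (fun n => u n i) (s i).
  split; apply: cauchy_seq_cvg => e /(uCi i)[N uN]; exists N => m n Nm Nn;
    apply: le_lt_trans (uN _ _ Nm Nn).
    by apply: le_trans (norm_Re_le_cabs _); rewrite ReD; case: (u n i).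
  by apply: le_trans (norm_Im_le_cabs _); rewrite ImD; case: (u n i).
(* With [n] and the number [P] of coordinates fixed, let [m] tend to infinity in the Cauchy
   estimate; the resulting bound is uniform in [P]. *)
have bound e : 0 < e -> exists N, forall n, (N <= n)%N ->
    forall P, sqsum (fun i => u n i - s i) P <= e ^+ 2.
  move=> e0; have [N uN] := uC e e0; exists N => n Nn P.
  have uP : sqsum (fun i => u n i - u m i) P @[m --> \oo] -->
      sqsum (fun i => u n i - s i) P.
    pose f i m := cabs (u n i - u m i) ^+ 2.
    apply: (@cvg_sum_ord _ _ _ _ P f (fun i => cabs (u n i - s i) ^+ 2)) => i _.
    rewrite /f; under eq_fun do rewrite cabs_sqr.
    rewrite cabs_sqr.
    have /cvgcM-/(_ (-1)) usN := us i.
    have : cvgc (fun=> u n i) (u n i) by apply: (@cvgc_near_cst _ _ _ 0).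
    move=> /cvgcD-/(_ _ _ usN); rewrite mulN1r => -[cR cI].
    under eq_fun do rewrite -mulN1r.
    by apply: cvgD; apply: cvgM.
  rewrite (norm_cvg_unique uP (cvgP _ uP)).
  apply: limr_le; first exact: cvgP uP.
  exists N => // m /= Nm.
  apply: (le_trans (sqsum_le_hnorm (u n - u m) P)).
  by rewrite ler_pXn2r ?nnegrE ?hnorm_ge0 // ltW // ?uN.
have sP : s \in l2_pred D.
  apply/l2_predP; split.
    (* The limit is square-summable because [s = u N - (u N - s)] and both terms are. *)
    have [N /(_ _ (leqnn N)) uN] := bound 1 ltr01.
    have sN : sqsummable (fun i => u N i - s i) by exists (1 ^+ 2).
    have := sqsummableD (l2_sqsummable (u N)) (sqsummableZ (-1) sN).
    by congr sqsummable; apply/funext => i; rewrite mulN1r opprB addrC subrK.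
  move=> i Di; apply: (@cvgc_unique _ (fun n => u n i)) => //.
  by apply: (@cvgc_near_cst _ _ _ 0) => n _; apply: l2_supp.
exists (L2 sP) => e e0.
(* Passing to the limit leaves only a non-strict inequality; halving [e] restores strictness. *)
have [N uN] := bound (e / 2) (divr_gt0 e0 (ltr0Sn R 1)).
exists N => n Nn; apply: (@le_lt_trans _ _ (e / 2)); last by lra.
rewrite -(ler_pXn2r (n := 2)) ?nnegrE ?hnorm_ge0 //; last by lra.
by apply: hnorm_le_sqsum => P; apply: uN.
Qed.

Lemma l2_hilbert : is_hilbert l2ip.
Proof. split; [exact: l2ip_inner|exact: l2_complete]. Qed.

(** The factor [D p] puts the vector into the space for every [p]: outside [D] it is zero. *)
Lemma l2_delta_subproof p : (fun i => ((i == p) && D p)%:R : R[i]) \in l2_pred D.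
Proof.
apply/l2_predP; split.
  exists 1 => n; rewrite /sqsum.
  apply: (@le_trans _ _ (\sum_(i < n) ((i : nat) == p)%:R)).
    apply: ler_sum => i _; case: (_ == _); case: (D p);
      by rewrite ?(mulr1n, mulr0n) ?cabs1 ?cabs0 ?expr1n ?expr0n.
  have [pn|np] := ltnP p n.
    rewrite (bigD1 (Ordinal pn)) //= eqxx big1 ?addr0 // => i.
    by rewrite -val_eqE /= => /negPf ->.
  by rewrite big1 // => i _; rewrite ltn_eqF // (leq_trans (ltn_ord i)).
by move=> i Di; case: eqP Di => //= -> /negPf ->.
Qed.

Definition l2_delta p : H := L2 (l2_delta_subproof p).

Lemma l2ip_delta a p : D p -> l2ip a (l2_delta p) = a p.
Proof.
move=> Dp; apply: l2ip_eq; apply: (@cvgc_near_cst _ _ _ p.+1) => n pn.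
rewrite (bigD1 (Ordinal pn)) //= eqxx Dp conjc1 mulr1 big1 ?addr0 // => i.
by rewrite -val_eqE /= => /negPf ->; rewrite conjc0 mulr0.
Qed.

Lemma l2_delta_orthonormal n (iota : nat -> nat) :
  (forall i, (i < n)%N -> D (iota i)) -> injective iota ->
  orthonormal l2ip n (fun i => l2_delta (iota i)).
Proof.
move=> Di inj i j ilt jlt; rewrite l2ip_delta ?Di //=.
by rewrite Di // andbT (inj_eq inj) eq_sym.
Qed.

End EllTwoHilbert.

Lemma l2_finite_dim (R : realType) (n : nat) :
  hfinite_dim (l2 R (fun i => (i < n)%N)).
Proof.
exists n, (fun i : 'I_n => l2_delta R (fun i => (i < n)%N) i) => a.
exists (fun i => a i); apply/val_inj/funext => p /=.
have sumE (r : seq 'I_n) : l2val (\sum_(i <- r) a i *: l2_delta R (fun i => (i < n)%N) i) p =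
    \sum_(i <- r) a i * ((p == i) && (i < n)%N)%:R.
  by elim: r => [|i r IH]; rewrite ?big_nil // !big_cons l2D IH l2Z.
rewrite sumE; have [pn|np] := ltnP p n.
  rewrite (bigD1 (Ordinal pn)) //= eqxx pn mulr1 big1 ?addr0 // => i.
  by rewrite -val_eqE /= eq_sym => /negPf ->; rewrite mulr0.
rewrite l2_supp -?leqNgt // big1 // => i _.
by rewrite gtn_eqF ?mulr0 // (leq_trans (ltn_ord i)).
Qed.

Lemma rat_complex_dense (R : realType) (z : R[i]) (e : R) : 0 < e ->
  exists q : rat * rat, cabs (z - complex.Complex (ratr q.1) (ratr q.2)) < e.
Proof.
move=> e0; case: z => x y.
have e2 : 0 < e / 2 by rewrite divr_gt0.
have near (t : R) : exists q : rat, `|t - ratr q| < e / 2.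
  have [|q] := @rat_in_itvoo R (t - e / 2) (t + e / 2); first by lra.
  by rewrite in_itv /= => /andP[q1 q2]; exists q; rewrite ltr_norml; lra.
have [[p xp] [q yq]] := (near x, near y); exists (p, q).
apply: (le_lt_trans (cabs_le_Re_Im _)); rewrite /=; lra.
Qed.

(** The dense set consists of finite combinations of unit vectors with coefficients in Q + iQ. They
    are coded by lists and enumerated by [unpickle], with the zero vector for numbers that code no
    list. *)
Lemma l2_separable (R : realType) : hseparable (@l2ip R predT).
Proof.
pose g := l2_delta R predT.
pose c (q : rat * rat) : R[i] := complex.Complex (ratr q.1) (ratr q.2).
have gP n : orthonormal (@l2ip R predT) n g.
  by apply: l2_delta_orthonormal => //; apply: inj_id.
pose comb (s : seq (rat * rat)) := \sum_(i < size s) c (nth (0, 0) s i) *: g i.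
exists (fun k => oapp comb 0 (unpickle k)) => a e e0.
have ipP := @l2ip_inner R predT.
have e2 : 0 < e / 2 by rewrite divr_gt0.
have [n an] : exists n, hnorm (@l2ip R predT) (a - oproj (@l2ip R predT) n g a) < e / 2.
  have := sqsum_cvg (l2_sqsummable a).
  move=> /cvgrPdist_lt-/(_ _ (exprn_gt0 2 e2))[n _ /(_ n (leqnn n)) /=].
  rewrite -l2_hnorm_sqr => an; exists n.
  rewrite -(ltr_pXn2r (n := 2)) ?nnegrE ?hnorm_ge0 //; last exact: ltW.
  rewrite hnorm_sqr_oproj // (_ : \sum_(i < n) _ = sqsum a n).
    exact: le_lt_trans (ler_norm _) an.
  by apply: eq_bigr => i _; rewrite l2ip_delta.
(* The remaining error [e / 2] is shared among [n] coefficients; dividing by [n + 1] also covers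
   [n = 0]. *)
have n0 : 0 < e / 2 / n.+1%:R by rewrite divr_gt0.
have /choice[q qP] : forall i, exists q, cabs (a i - c q) < e / 2 / n.+1%:R.
  by move=> i; apply: rat_complex_dense.
exists (pickle (mkseq q n)); rewrite pickleK /=.
apply: (le_lt_trans (hnormB ipP _ (oproj (@l2ip R predT) n g a) _)).
suff : hnorm (@l2ip R predT) (oproj (@l2ip R predT) n g a - comb (mkseq q n)) <= e / 2.
  by lra.
have -> : comb (mkseq q n) = \sum_(i < n) c (q i) *: g i.
  by rewrite /comb size_mkseq; apply: eq_bigr => i _; rewrite nth_mkseq.
rewrite /oproj -sumrB; apply: (le_trans (hnorm_sum ipP _ _ _)).
apply: (@le_trans _ _ (\sum_(i < n) e / 2 / n.+1%:R)).
  apply: ler_sum => i _; rewrite l2ip_delta // -scalerBl hnormZ //.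
  have -> : hnorm (@l2ip R predT) (g i) = 1.
    by rewrite /hnorm (gP i.+1) // eqxx cabs1 sqrtr1.
  by rewrite mulr1 ltW.
rewrite sumr_const card_ord -[_ *+ n]mulr_natr -mulrA.
apply: ler_piMr; first exact: ltW.
by rewrite ler_pdivrMl ?ltr0n // mulr1 ler_nat leqnSn.
Qed.

(** * Coordinates and uniform bounds *)

Section Transfer.
Variables (R : realType) (V W : lmodType R[i]).
Variables (ipV : V -> V -> R[i]) (ipW : W -> W -> R[i]).
Hypotheses (ipVP : is_inner_product ipV) (ipWP : is_inner_product ipW).

(** For orthonormal [e] and [g] this is the partial isometry taking [e i] to [g i] and killing the
    orthogonal complement of the [e i]; its adjoint is obtained by exchanging the two families. *)
Definition transfer (d : nat) (e : nat -> V) (g : nat -> W) (v : V) : W :=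
  \sum_(i < d) ipV v (e i) *: g i.

Lemma transfer_sum d e g (I : Type) (r : seq I) (P : pred I)
    (a : I -> R[i]) (F : I -> V) :
  transfer d e g (\sum_(j <- r | P j) a j *: F j) =
  \sum_(j <- r | P j) a j *: transfer d e g (F j).
Proof.
under [RHS]eq_bigr do rewrite scaler_sumr.
rewrite exchange_big /=; apply: eq_bigr => i _.
rewrite ip_suml // scaler_suml; apply: eq_bigr => j _.
by rewrite ipZl // scalerA.
Qed.

(** Pythagoras in the target turns the squared norm into the sum of the squared coefficients, which
    Bessel's inequality bounds in the source. *)
Lemma hnorm_transfer d e g (v : V) :
  orthonormal ipV d e -> orthonormal ipW d g ->
  hnorm ipW (transfer d e g v) <= hnorm ipV v.
Proof.
move=> eP gP; rewrite -(ler_pXn2r (n := 2)) ?nnegrE ?hnorm_ge0 //.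
rewrite (hnorm_sqr_sum (F := fun i => ipV v (e i) *: g i) ipWP).
  apply: le_trans (bessel_oproj ipVP eP v); apply: ler_sum => i _.
  rewrite hnormZ // exprMn hnorm_sqrE //.
  by rewrite gP // eqxx cabs1 mulr1.
move=> i j ilt jlt /negPf ij.
by rewrite ipZl // ipZr // gP // ij !mulr0.
Qed.

End Transfer.

Section TransferAdjoint.
Variables (R : realType) (V W : lmodType R[i]).
Variables (ipV : V -> V -> R[i]) (ipW : W -> W -> R[i]).
Hypotheses (ipVP : is_inner_product ipV) (ipWP : is_inner_product ipW).
Variables (d : nat) (e : nat -> V) (g : nat -> W).

Lemma transfer_adj v w :
  ipW (transfer ipV d e g v) w = ipV v (transfer ipW d g e w).
Proof.
rewrite ip_suml // ip_sumr //; apply: eq_bigr => i _.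
by rewrite ipZl // ipZr // -(ip_conj ipWP) mulrC.
Qed.

Lemma transferK v : orthonormal ipW d g ->
  transfer ipW d g e (transfer ipV d e g v) = oproj ipV d e v.
Proof.
move=> gP; apply: eq_bigr => i _.
by rewrite (ip_lincomb ipWP gP (fun i => ipV v (e i))).
Qed.

(** Adjoint after map is the projection, and it fixes [x]. The vector [y] stays arbitrary, which
    suits the test vectors of a Bessel bound. *)
Lemma transfer_ip y x : orthonormal ipW d g -> oproj ipV d e x = x ->
  ipW (transfer ipV d e g y) (transfer ipV d e g x) = ipV y x.
Proof. by move=> gP ex; rewrite transfer_adj transferK // ex. Qed.

End TransferAdjoint.

(** * Uniform boundedness *)

Section UniformBounds.
Variables (R : realType) (V : lmodType R[i]) (ip : V -> V -> R[i]).
Hypothesis ipP : is_inner_product ip.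
Local Notation "`[ x ]" := (hnorm ip x) (format "`[ x ]").

(* Gliding hump: unboundedness yields disjoint blocks [n, next n) and signs on
   them whose sums exceed 1; gluing these signs contradicts convergence. *)
Lemma unconditional_bounded (v : nat -> V) :
  (forall eps : nat -> R[i], (forall j, cabs (eps j) = 1) ->
     hseries_converges ip (fun j => eps j *: v j)) ->
  exists M : R, forall (N : nat) (eps : nat -> R[i]), (forall j, cabs (eps j) = 1) ->
     `[\sum_(j < N) eps j *: v j] <= M.
Proof.
move=> vC; apply: contrapT => nM.
have blk (n : nat) : exists p : nat * (nat -> R[i]), [/\ (n < p.1)%N,
    forall j, cabs (p.2 j) = 1 & 1 < `[\sum_(n <= j < p.1) p.2 j *: v j]].
  apply: contrapT => nb; apply: nM.
  pose M := \sum_(j < n) `[v j].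
  have M0 : 0 <= M by apply: sumr_ge0 => j _; apply: hnorm_ge0.
  have small N (eps : nat -> R[i]) : (forall j, cabs (eps j) = 1) -> (N <= n)%N ->
      `[\sum_(j < N) eps j *: v j] <= M.
    move=> e1 Nn; apply: (le_trans (hnorm_sum ipP _ _ _)).
    rewrite /M -(subnKC Nn) big_split_ord /= ler_wpDr //.
      by apply: sumr_ge0 => j _; apply: hnorm_ge0.
    by apply: ler_sum => j _; rewrite hnormZ // e1 mul1r.
  (* The first [n] terms contribute at most [M], and if no block from [n] on is large, the rest
     contributes at most 1. *)
  exists (M + 1) => N eps e1; have [Nn|nN] := leqP N n.
    by apply: le_trans (small _ _ e1 Nn) _; rewrite lerDl.
  rewrite -(big_mkord xpredT (fun j => eps j *: v j)).
  rewrite (big_cat_nat (n := n)) //=; last exact: ltnW.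
  apply: (le_trans (hnormD ipP _ _)); apply: lerD.
    by rewrite big_mkord small.
  by rewrite leNgt; apply/negP => gt1; apply: nb; exists (N, eps).
have {blk} [p pP] := choice blk.
(* [start j] is the left end of the block containing [j]; the left ends are exactly the fixed points
   of [start]. *)
pose start := fix start j := if j is k.+1 then
  (if (j < (p (start k)).1)%N then start k else j) else 0%N.
have startE n : start n = n -> forall j, (n <= j < (p n).1)%N -> start j = n.
  move=> sn; elim=> [|j IH]; first by rewrite leqn0 => /andP[/eqP <-].
  rewrite leq_eqVlt => /andP[/orP[/eqP <- _ //|nj] jp] /=.
  by rewrite IH ?jp //; apply/andP; split; [|exact: ltnW].
have start_next n : start n = n -> start (p n).1 = (p n).1.
  move=> sn; have [np _ _] := pP n.
  case E : (p n).1 (np) => [//|k] nk /=.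
  by rewrite (startE n) ?E ?ltnn //; apply/andP; split; rewrite ?E.
pose eps j := (p (start j)).2 j.
have e1 j : cabs (eps j) = 1 by have [_ + _] := pP (start j); apply.
(* Two partial sums within 1/2 of the limit differ by less than 1, whereas each block sum exceeds
   1. *)
have [s /(_ (2^-1))[|N sN]] := vC eps e1; first by rewrite invr_gt0.
have [n Nn sn] : exists2 n, (N <= n)%N & start n = n.
  elim: N {sN} => [|k [n kn sn]]; first by exists 0%N.
  exists (p n).1; last exact: start_next.
  by have [np _ _] := pP n; apply: leq_ltn_trans np.
have [np _] := pP n; apply/negP; rewrite -leNgt.
rewrite (_ : \sum_(n <= j < (p n).1) _ =
  (\sum_(j < (p n).1) eps j *: v j - s) - (\sum_(j < n) eps j *: v j - s)).
  apply: (le_trans (hnormD ipP _ _)); rewrite hnormN //.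
  have := sN _ Nn; have := sN _ (leq_trans Nn (ltnW np)); lra.
rewrite opprB addrA subrK -!(big_mkord xpredT (fun j => eps j *: v j)).
rewrite (@big_cat_nat _ _ _ n 0 (p n).1) //=; last exact: ltnW.
rewrite addrC addKr; apply: eq_big_nat => j nj.
by rewrite /eps (startE n).
Qed.

(** A nested-ball argument for seminorms: if the family is uniformly bounded on no ball, shrinking
    balls on which some [p i] exceeds [n] have a common point by completeness, against the pointwise
    bound. A ball with a uniform bound then gives the constant by scaling. *)
Lemma uniform_boundedness (I : Type) (p : I -> V -> R) : hcomplete ip ->
  (forall i x y, p i (x + y) <= p i x + p i y) ->
  (forall i a x, p i (a *: x) = cabs a * p i x) ->
  (forall i, exists K, forall x, p i x <= K * `[x]) ->
  (forall x, exists M, forall i, p i x <= M) ->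
  exists2 C : R, 0 < C & forall i x, p i x <= C * `[x].
Proof.
move=> complete pD pZ pK pM.
have pN i x : p i (- x) = p i x by rewrite -scaleN1r pZ cabsN cabs1 mul1r.
have [y0 [r [M [r0 yM]]]] : exists (y0 : V) (r M : R), 0 < r /\
    forall i z, `[z - y0] <= r -> p i z <= M.
  apply: contrapT => nball.
  (* A state is a centre with a radius. Positivity of the radius is a premise under the existential,
     so that choice yields a total step function. *)
  have step (n : nat) (s : V * R) : exists s' : V * R, 0 < s.2 ->
      [/\ 0 < s'.2, s'.2 <= s.2 / 2, s'.2 <= n.+1%:R^-1, `[s'.1 - s.1] <= s.2 / 2
        & exists i, forall z, `[z - s'.1] <= s'.2 -> n%:R < p i z].
    have [r0|] := ltP 0 s.2; last by exists s.
    have [i [z [zs iz]]] : exists i z, `[z - s.1] <= s.2 / 2 /\ n.+1%:R < p i z.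
      apply: contrapT => nz; apply: nball; exists s.1, (s.2 / 2), n.+1%:R.
      split=> [|i z zs]; first by rewrite divr_gt0.
      by rewrite leNgt; apply/negP => ltz; apply: nz; exists i, z.
    have [K iK] := pK i.
    have K1 : 0 < `|K| + 1 by rewrite ltr_wpDl.
    (* The three bounds keep the new ball inside the old one, force the radii to 0, and let [p i]
       vary by at most 1 on the ball, so that a value above [n + 1] at the centre stays above
       [n]. *)
    pose r' := Num.min (s.2 / 2) (Num.min n.+1%:R^-1 (`|K| + 1)^-1).
    have r'K : r' <= (`|K| + 1)^-1 by rewrite /r' !ge_min lexx !orbT.
    have r'0 : 0 < r' by rewrite !lt_min !invr_gt0 ltr0n K1 divr_gt0.
    exists (z, r') => _; split=> //=.
    - by rewrite /r' ge_min lexx.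
    - by rewrite /r' !ge_min lexx orbT.
    exists i => w wz; rewrite -natr1 in iz.
    have := pD i w (z - w); rewrite [w + _]addrC subrK => pz.
    have pzw : p i (z - w) <= 1.
      apply: (le_trans (iK _)); apply: (@le_trans _ _ ((`|K| + 1) * `[z - w])).
        apply: ler_wpM2r; first exact: hnorm_ge0.
        by have := ler_norm K; lra.
      rewrite hnormC // mulrC -ler_pdivlMr // div1r.
      exact: le_trans r'K.
    lra.
  have {step} [stp stpP] := choice (fun ns : nat * (V * R) => step ns.1 ns.2).
  pose st := fix st n := if n is k.+1 then stp (k, st k) else (0 : V, 1 : R).
  have st0 n : 0 < (st n).2.
    by elim: n => [|n IH] /=; [|have [] := stpP (n, st n) IH].
  have stS n := stpP (n, st n) (st0 n).
  (* Each step moves the centre by at most half the radius while the radius drops by at least half,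
     so the displacements telescope. *)
  have near_ n k : `[(st (n + k)%N).1 - (st n).1] <= (st n).2 - (st (n + k)%N).2.
    elim: k => [|k IH]; first by rewrite addn0 !subrr hnorm0.
    rewrite addnS; apply: (le_trans (hnormB ipP _ (st (n + k)%N).1 _)).
    have [_ /= h1 _ h2 _] := stS (n + k)%N; lra.
  have near n m : (n <= m)%N -> `[(st m).1 - (st n).1] <= (st n).2.
    move=> nm; rewrite -(subnKC nm); apply: (le_trans (near_ _ _)).
    by rewrite lerBlDr lerDl ltW.
  have [y yP] : exists y, hcvg_to ip (fun n => (st n).1) y.
    apply: complete => e e0.
    have [N Ne] : exists N, (st N).2 < e / 2.
      have e2 : 0 < 2 / e by rewrite divr_gt0.
      pose N := Num.bound (2 / e); exists N.+1; have [_ _ /= h _ _] := stS N.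
      apply: (le_lt_trans h); rewrite -[e / 2]invf_div ltf_pV2 ?posrE ?ltr0n //.
      by apply: (lt_trans (archi_boundP (ltW e2))); rewrite ltr_nat.
    exists N => m n Nm Nn; apply: (le_lt_trans (hnormB ipP _ (st N).1 _)).
    by rewrite (hnormC ipP (st N).1); have := near _ _ Nm; have := near _ _ Nn; lra.
  have ynear n : `[y - (st n).1] <= (st n).2.
    apply/ler_addgt0Pr => e /yP[N yN].
    apply: (le_trans (hnormB ipP _ (st (maxn n N)).1 _)).
    rewrite (hnormC ipP y); have := yN _ (leq_maxr n N).
    by have := near _ _ (leq_maxl n N); lra.
  have [M yM] := pM y; pose n := Num.bound `|M|.
  have [_ _ _ _ [i iP]] := stS n.
  have := iP _ (ynear n.+1); have := yM i.
  by have := archi_boundP (normr_ge0 M); have := ler_norm M; rewrite -/n; lra.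
exists (`|2 * M / r| + 1) => [|i x]; first by rewrite ltr_wpDl.
have [->|x0] := eqVneq x 0.
  by rewrite -(scale0r (0 : V)) pZ hnormZ // cabs0 !mul0r mulr0.
have nx := hnorm_gt0 ipP x0.
pose t := r / `[x]; have t0 : 0 < t by rewrite divr_gt0.
have ct : cabs t%:C%C = t by rewrite cabs_real gtr0_norm.
pose v := t%:C%C *: x.
have vr : `[v] = r by rewrite hnormZ // ct divfK ?gt_eqF.
(* Scaled to norm [r], the vector [x] is the difference of the points [y0 + v] and [y0] of the
   ball. *)
have pv : t * p i x <= 2 * M.
  rewrite -ct -pZ -/v; have := pD i (y0 + v) (- y0); rewrite addrC addKr pN.
  have := yM i (y0 + v); rewrite [y0 + v]addrC addrK vr => /(_ (lexx _)).
  have := yM i y0; rewrite subrr hnorm0 // => /(_ (ltW r0)); lra.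
apply: (@le_trans _ _ (2 * M / r * `[x])).
  rewrite (_ : _ * `[x] = t^-1 * (2 * M)) ?ler_pdivlMl // /t invf_div; ring.
by rewrite ler_wpM2r // ?hnorm_ge0 //; have := ler_norm (2 * M / r); lra.
Qed.

End UniformBounds.

(** * From finite systems to sequences *)

Definition finite_factorization (R : realType) (kappa : R) :=
  forall (Cst : R), 0 < Cst ->
  forall (V : lmodType R[i]) (ip : V -> V -> R[i]),
    is_hilbert ip -> hfinite_dim V ->
    forall (n : nat) (m : 'I_n -> R[i]) (x f : 'I_n -> V),
      (forall (y : V) (eps : 'I_n -> R[i]), (forall j, cabs (eps j) = 1) ->
         hnorm ip (\sum_(j < n) (eps j * m j * ip y (f j)) *: x j)
           <= Cst * hnorm ip y) ->
      exists c d : 'I_n -> R[i],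
        (forall j, c j * conjc (d j) = m j) /\
        has_bessel_bound_fin ip (Cst * kappa) (fun j => c j *: x j) /\
        has_bessel_bound_fin ip (Cst * kappa) (fun j => d j *: f j).

Section FiniteToInfinite.
Variables (R : realType) (V : lmodType R[i]) (ip : V -> V -> R[i]).
Hypothesis ipP : is_inner_product ip.
Local Notation "`[ x ]" := (hnorm ip x) (format "`[ x ]").

(* The span of the x_j and f_j is replaced by its isometric copy in coordinates. *)
Lemma finite_factorization_span (kappa Cst : R) (n : nat) (m : 'I_n -> R[i])
    (x f : 'I_n -> V) :
  0 < kappa -> finite_factorization kappa -> 0 < Cst ->
  (forall (y : V) (eps : 'I_n -> R[i]), (forall j, cabs (eps j) = 1) ->
     `[\sum_(j < n) (eps j * m j * ip y (f j)) *: x j] <= Cst * `[y]) ->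
  exists c d : 'I_n -> R[i],
    (forall j, c j * conjc (d j) = m j) /\
    has_bessel_bound_fin ip (Cst * kappa) (fun j => c j *: x j) /\
    has_bessel_bound_fin ip (Cst * kappa) (fun j => d j *: f j).
Proof.
move=> k0 Hfin C0 Hxf.
have [d [e [eP es]]] := gram_schmidt ipP ([seq x j | j <- enum 'I_n] ++
  [seq f j | j <- enum 'I_n]).
have ex j : oproj ip d e (x j) = x j.
  by apply: es; rewrite mem_cat map_f // mem_enum.
have ef j : oproj ip d e (f j) = f j.
  by apply: es; rewrite mem_cat orbC map_f // mem_enum.
pose D := fun i => (i < d)%N.
pose g := l2_delta R D.
have iwP := @l2ip_inner R D.
have gP : orthonormal (@l2ip R D) d g by apply: l2_delta_orthonormal.
pose J := transfer ip d e g.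
have [] := Hfin Cst C0 _ _ (l2_hilbert R D) (l2_finite_dim R d) n m
  (fun j => J (x j)) (fun j => J (f j)).
  (* The hypothesis is tested at the adjoint image [y'] of [y], whose norm is at most that of
     [y]. *)
  move=> y eps e1; pose y' := transfer (@l2ip R D) d g e y.
  have -> : \sum_(j < n) (eps j * m j * l2ip y (J (f j))) *: J (x j) =
      J (\sum_(j < n) (eps j * m j * ip y' (f j)) *: x j).
    rewrite /J transfer_sum //; apply: eq_bigr => j _.
    by rewrite /y' transfer_adj.
  apply: (le_trans (hnorm_transfer ipP iwP _ eP gP)).
  apply: (le_trans (Hxf _ _ e1)); rewrite ler_pM2l //.
  exact: hnorm_transfer.
move=> c [b [cb [cx bf]]]; exists c, b; split=> //.
(* Test the bound in coordinates at [J y]: the inner products agree because the [z j] lie in the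
   span, and [J] does not increase the norm. *)
have pull (w : 'I_n -> R[i]) (z : 'I_n -> V) :
    (forall j, oproj ip d e (z j) = z j) ->
    has_bessel_bound_fin (@l2ip R D) (Cst * kappa) (fun j => w j *: J (z j)) ->
    has_bessel_bound_fin ip (Cst * kappa) (fun j => w j *: z j).
  move=> ez Hz y; apply: (@le_trans _ _ (Cst * kappa * hnorm (@l2ip R D) (J y) ^+ 2)).
    apply: le_trans (Hz (J y)); apply: ler_sum => j _.
    by rewrite !ipZr // /J transfer_ip.
  apply: ler_wpM2l; first by rewrite mulr_ge0 ?ltW.
  by rewrite ler_pXn2r ?nnegrE ?hnorm_ge0 //; apply: hnorm_transfer.
by split; apply: pull.
Qed.

(** Only the squared moduli of the scalars enter a Bessel bound. Writing them as real weights
    discards the phases before the passage to the limit. *)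
Definition weighted_bessel (B : R) (N : nat) (a : nat -> R) (z : nat -> V) :=
  forall y : V, \sum_(j < N) a j * cabs (ip y (z j)) ^+ 2 <= B * `[y] ^+ 2.

Lemma finite_weights (kappa Cst : R) (N : nat) (m : nat -> R[i]) (x f : nat -> V) :
  0 < kappa -> finite_factorization kappa -> 0 < Cst ->
  (forall (y : V) (eps : nat -> R[i]), (forall j, cabs (eps j) = 1) ->
     `[\sum_(j < N) (eps j * m j * ip y (f j)) *: x j] <= Cst * `[y]) ->
  exists p : (nat -> R) * (nat -> R), [/\ forall j, 0 <= p.1 j, forall j, 0 <= p.2 j,
    forall j, (j < N)%N -> p.1 j * p.2 j = cabs (m j) ^+ 2,
    weighted_bessel (Cst * kappa) N p.1 x & weighted_bessel (Cst * kappa) N p.2 f].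
Proof.
move=> k0 Hfin C0 Hxf.
have [|c [d [cd [cx df]]]] := @finite_factorization_span kappa Cst N
    (fun j => m j) (fun j => x j) (fun j => f j) k0 Hfin C0.
  move=> y eps e1.
  (* The signs are continued by 1 beyond the first [N] indices. *)
  have := Hxf y (fun j => oapp eps 1 (insub j)).
  under eq_bigr do rewrite valK /=.
  by apply=> j; case: (insub j) => [i|] /=; [exact: e1|exact: cabs1].
pose w (c : 'I_N -> R[i]) j := oapp (fun i => cabs (c i) ^+ 2) 0 (insub j).
have w0 b j : 0 <= w b j by rewrite /w; case: insub => //= i; apply: sqr_ge0.
have wB b z : has_bessel_bound_fin ip (Cst * kappa) (fun j => b j *: z (val j)) ->
    weighted_bessel (Cst * kappa) N (w b) z.
  move=> bz y; apply: le_trans (bz y); apply: ler_sum => j _.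
  by rewrite /w valK /= ipZr // cabsM cabs_conj exprMn.
exists (w c, w d); split=> //=; [|exact: wB|exact: wB].
move=> j jN; rewrite /w (insubT (fun j => j < N)%N jN) /=.
by rewrite -exprMn -[X in _ * X]cabs_conj -cabsM cd.
Qed.

(** Testing the bound at [z j] itself gives [A N j <= B / |z j|^2] once [N > j], so the ultrafilter
    limit exists where [z j] is nonzero; elsewhere the weight is set to 0. *)
Lemma weighted_bessel_limit (U : set_system nat) (A : nat -> nat -> R)
    (z : nat -> V) (B : R) :
  UltraFilter U -> \oo `<=` U -> (forall N j, 0 <= A N j) ->
  (forall N, weighted_bessel B N (A N) z) ->
  exists a : nat -> R, [/\ forall j, 0 <= a j,
    forall j, z j != 0 -> A N j @[N --> U] --> a j
    & forall N, weighted_bessel B N a z].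
Proof.
move=> UU ooU A0 AB.
have /choice[a aP] j : exists l : R, 0 <= l /\ (z j != 0 -> A N j @[N --> U] --> l).
  have [zj|zj] := eqVneq (z j) 0; first by exists 0.
  have zn : 0 < `[z j] ^+ 2 by rewrite exprn_gt0 // hnorm_gt0.
  have [N jN|l l0 lP] := @ultra_bounded_cvg R U (fun N => A N j) j.+1
      (B / `[z j] ^+ 2) UU ooU; last by exists l.
  rewrite A0 /= ler_pdivlMr // -(ler_pM2r zn) -mulrA -expr2.
  apply: le_trans (AB N (z j)); rewrite (bigD1 (Ordinal jN)) //= -hnorm_sqrE.
  by rewrite lerDl; apply: sumr_ge0 => i _; rewrite mulr_ge0 ?sqr_ge0.
exists a; split=> [j|j|N y]; [by have [] := aP j|by have [] := aP j|].
pose F j n := A n j * cabs (ip y (z j)) ^+ 2.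
have : \sum_(j < N) F j n @[n --> U] --> \sum_(j < N) a j * cabs (ip y (z j)) ^+ 2.
  apply: (@cvg_sum_ord _ _ _ _ N F (fun j => a j * cabs (ip y (z j)) ^+ 2)) => j _.
  rewrite /F; have [->|zj] := eqVneq (z j) 0.
    by rewrite ip0r // cabs0 expr0n mulr0; under eq_fun do rewrite mulr0;
      apply: cvg_cst.
  by apply: cvgM; [have [_] := aP j; apply|apply: cvg_cst].
move=> FU; rewrite (norm_cvg_unique FU (cvgP _ FU)); apply: limr_le.
  exact: cvgP FU.
(* For [n >= N] the first [N] terms are part of a sum of [n] nonnegative terms that obeys the
   bound. *)
apply: ooU; exists N => // n /= Nn; apply: le_trans (AB n y).
rewrite -(subnKC Nn) big_split_ord /= lerDl.
by apply: sumr_ge0 => i _; rewrite mulr_ge0 ?sqr_ge0.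
Qed.

(** Cauchy-Schwarz with [t = sqrt eta / (1 + |v|)]; the added 1 covers [v = 0]. *)
Lemma small_weight (v : V) (eta : R) : 0 < eta ->
  exists2 t : R, 0 < t & forall y, t ^+ 2 * cabs (ip y v) ^+ 2 <= eta * `[y] ^+ 2.
Proof.
move=> eta0; have v1 : 0 < 1 + `[v] by rewrite ltr_pwDl ?hnorm_ge0.
exists (Num.sqrt eta / (1 + `[v])) => [|y]; first by rewrite divr_gt0 ?sqrtr_gt0.
rewrite exprMn sqr_sqrtr; last exact: ltW.
rewrite -mulrA -exprMn; apply: ler_wpM2l; first exact: ltW.
rewrite ler_pXn2r ?nnegrE ?hnorm_ge0 ?mulr_ge0 ?cabs_ge0 ?invr_ge0 ?(ltW v1) //.
rewrite ler_pdivrMl //; apply: (le_trans (cauchy_schwarz ipP _ _)).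
by rewrite mulrC; apply: ler_wpM2r; rewrite ?hnorm_ge0 // lerDr.
Qed.

(* When x or f vanishes the limit weights a and b carry no information, and the
   nonvanishing vector gets a weight of size eta instead. *)
Lemma split_multiplier (m : R[i]) (x f : V) (a b eta : R) :
  0 <= a -> 0 <= b -> 0 < eta ->
  (x != 0 -> f != 0 -> a * b = cabs m ^+ 2) ->
  exists p : R[i] * R[i], [/\ p.1 * conjc p.2 = m,
    forall y, cabs (ip y (p.1 *: x)) ^+ 2 <= a * cabs (ip y x) ^+ 2 + eta * `[y] ^+ 2
    & forall y, cabs (ip y (p.2 *: f)) ^+ 2 <= b * cabs (ip y f) ^+ 2 + eta * `[y] ^+ 2].
Proof.
move=> a0 b0 eta0 ab.
have rhs (r : R) v y : 0 <= r -> 0 <= r * cabs (ip y v) ^+ 2 + eta * `[y] ^+ 2.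
  by move=> r0; apply: addr_ge0; apply: mulr_ge0; rewrite ?sqr_ge0 // ltW.
have zeroB (r : R) (c : R[i]) y : 0 <= r ->
    cabs (ip y (c *: 0)) ^+ 2 <= r * cabs (ip y 0) ^+ 2 + eta * `[y] ^+ 2.
  by move=> r0; rewrite scaler0 ip0r // {1}cabs0 expr0n -(ip0r ipP y) rhs.
have smallB (r t : R) v : 0 <= r -> 0 < t ->
    (forall y, t ^+ 2 * cabs (ip y v) ^+ 2 <= eta * `[y] ^+ 2) ->
    forall y, cabs (ip y (t%:C%C *: v)) ^+ 2 <=
      r * cabs (ip y v) ^+ 2 + eta * `[y] ^+ 2.
  move=> r0 t0 tP y; rewrite ipZr // conjc_real cabsM cabs_real gtr0_norm // exprMn.
  by apply: (le_trans (tP y)); rewrite lerDr mulr_ge0 ?sqr_ge0.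
have rC (t : R) : 0 < t -> t%:C%C != 0 :> R[i].
  by move=> t0; rewrite (inj_eq (@complexI R)) gt_eqF.
have [x0|x0] := eqVneq x 0.
  have [t t0 tP] := small_weight f eta0.
  exists (m / t%:C%C, t%:C%C); split=> [|y|].
  - by rewrite [conjc _]conjc_real; apply: divfK; apply: rC.
  - by rewrite x0 zeroB.
  - exact: smallB.
have [f0|f0] := eqVneq f 0.
  have [t t0 tP] := small_weight x eta0.
  exists (t%:C%C, conjc (m / t%:C%C)); split=> [||y] /=.
  - by rewrite conjcK mulrC divfK ?rC.
  - exact: smallB.
  - by rewrite f0 zeroB.
have {}ab := ab x0 f0.
(* A zero multiplier allows [a = 0], so it is split as [0 * 0]. Otherwise [a b = |m|^2] forces [a]
   to be nonzero. *)
have [m0|m0] := eqVneq m 0.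
  exists (0, 0); split=> [|y|y] /=; first by rewrite mul0r m0.
    by rewrite scale0r ip0r // {1}cabs0 expr0n rhs.
  by rewrite scale0r ip0r // {1}cabs0 expr0n rhs.
have am : a != 0.
  apply: contra m0 => /eqP a00; rewrite -cabs_eq0 -sqrf_eq0 -ab a00.
  by rewrite mul0r.
have a1 : 0 < a by rewrite lt_def am.
have s0 : 0 < Num.sqrt a by rewrite sqrtr_gt0.
(* With [c = sqrt a] the other factor has squared modulus [|m|^2 / a = b]. *)
exists ((Num.sqrt a)%:C%C, conjc (m / (Num.sqrt a)%:C%C)); split=> [|y|y] /=.
- by rewrite conjcK mulrC divfK ?rC.
- rewrite ipZr // conjc_real cabsM cabs_real gtr0_norm // exprMn sqr_sqrtr //.
  by rewrite lerDl; apply: mulr_ge0; rewrite ?sqr_ge0 // ltW.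
- rewrite ipZr // conjcK !cabsM cabsV cabs_real gtr0_norm // !exprMn exprVn.
  rewrite sqr_sqrtr // -ab [a * b]mulrC mulfK //.
  by rewrite lerDl; apply: mulr_ge0; rewrite ?sqr_ge0 // ltW.
Qed.

Lemma finite_to_infinite (kappa : R) (m : nat -> R[i]) (x f : nat -> V) :
  hcomplete ip -> 0 < kappa -> finite_factorization kappa ->
  (forall (y : V) (eps : nat -> R[i]), (forall j, cabs (eps j) = 1) ->
     hseries_converges ip (fun j => (eps j * m j * ip y (f j)) *: x j)) ->
  exists c d : nat -> R[i],
    (forall j, c j * conjc (d j) = m j) /\
    is_bessel ip (fun j => c j *: x j) /\
    is_bessel ip (fun j => d j *: f j).
Proof.
move=> complete k0 Hfin Hxf.
(* Uniform boundedness is applied to the operators indexed by a length and a sign sequence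
   together. *)
pose S (i : nat * {eps : nat -> R[i] | forall j, cabs (eps j) = 1}) (y : V) :=
  \sum_(j < i.1) (sval i.2 j * m j * ip y (f j)) *: x j.
have [C C0 SC] : exists2 C : R, 0 < C & forall i y, `[S i y] <= C * `[y].
  apply: (uniform_boundedness ipP complete (p := fun i y => `[S i y])).
  - move=> i y z; rewrite (_ : S i (y + z) = S i y + S i z) ?hnormD //.
    rewrite /S -big_split; apply: eq_bigr => j _ /=.
    by rewrite ipDl // mulrDr scalerDl.
  - move=> i a y; rewrite -hnormZ // (_ : S i (a *: y) = a *: S i y) //.
    rewrite /S scaler_sumr; apply: eq_bigr => j _.
    by rewrite (ipZl ipP) scalerA; congr (_ *: _); ring.
  - move=> i; exists (\sum_(j < i.1) cabs (sval i.2 j * m j) * `[f j] * `[x j]) => y.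
    apply: (le_trans (hnorm_sum ipP _ _ _)); rewrite mulr_suml.
    apply: ler_sum => j _; rewrite hnormZ // cabsM.
    rewrite -!mulrA ler_wpM2l ?cabs_ge0 // [`[f j] * _]mulrCA mulrC.
    rewrite ler_wpM2l ?hnorm_ge0 // mulrC; exact: cauchy_schwarz.
  - move=> y.
    have [|M MP] := unconditional_bounded ipP (v := fun j => (m j * ip y (f j)) *: x j).
      move=> eps e1; have := Hxf y eps e1; congr hseries_converges.
      by apply/funext => j /=; rewrite scalerA mulrA.
    exists M => -[N [eps e1]]; apply: le_trans (MP N eps e1); rewrite /S /=.
    by under eq_bigr do rewrite -mulrA -scalerA.
have wN N : exists p : (nat -> R) * (nat -> R), [/\ forall j, 0 <= p.1 j,
    forall j, 0 <= p.2 j,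
    forall j, (j < N)%N -> p.1 j * p.2 j = cabs (m j) ^+ 2,
    weighted_bessel (C * kappa) N p.1 x & weighted_bessel (C * kappa) N p.2 f].
  apply: finite_weights => // y eps e1; exact: (SC (N, exist _ eps e1) y).
have {wN} [p pP] := choice wN.
have [U [UU ooU]] := ultraFilterLemma (F := \oo) _.
have [|N|a [a0 aU aB]] := @weighted_bessel_limit U (fun N => (p N).1) x
    (C * kappa) UU ooU.
- by move=> N j; have [] := pP N.
- by have [] := pP N.
have [|N|b [b0 bU bB]] := @weighted_bessel_limit U (fun N => (p N).2) f
    (C * kappa) UU ooU.
- by move=> N j; have [] := pP N.
- by have [] := pP N.
have ab j : x j != 0 -> f j != 0 -> a j * b j = cabs (m j) ^+ 2.
  move=> /aU aj /bU bj.
  have abj : (p N).1 j * (p N).2 j @[N --> U] --> a j * b j by apply: cvgM.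
  (* The product is constantly [|m j|^2] for [N > j], so its limit is forced. *)
  suff mj : (p N).1 j * (p N).2 j @[N --> U] --> cabs (m j) ^+ 2.
    exact: (norm_cvg_unique abj mj).
  apply/cvgrPdist_lt => e e0; apply: ooU; exists j.+1 => // N /= jN.
  by have [_ _ -> // _ _] := pP N; rewrite subrr normr0.
have h0 j : 0 < (2^-1 : R) ^+ j by rewrite exprn_gt0 // invr_gt0.
have [cd cdP] := choice (fun j => split_multiplier (a0 j) (b0 j) (h0 j) (@ab j)).
have bessel (q : nat -> R[i]) (w : nat -> R) (z : nat -> V) :
    (forall j y, cabs (ip y (q j *: z j)) ^+ 2 <=
      w j * cabs (ip y (z j)) ^+ 2 + 2^-1 ^+ j * `[y] ^+ 2) ->
    (forall N, weighted_bessel (C * kappa) N w z) ->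
    is_bessel ip (fun j => q j *: z j).
  (* The extra 2 bounds the sum of the allowances [2^-j] made at the individual indices. *)
  move=> qP wB; exists (C * kappa + 2) => y N.
  apply: (@le_trans _ _ (\sum_(j < N) (w j * cabs (ip y (z j)) ^+ 2 +
    2^-1 ^+ j * `[y] ^+ 2))); first by apply: ler_sum => j _; apply: qP.
  rewrite big_split /= mulrDl; apply: lerD; first exact: wB.
  by rewrite -mulr_suml ler_wpM2r ?sqr_ge0 ?sum_half_pow.
exists (fun j => (cd j).1), (fun j => (cd j).2); split; last split.
- by move=> j; have [] := cdP j.
- by apply: (bessel _ a) => // j y; have [_ + _] := cdP j; apply.
- by apply: (bessel _ b) => // j y; have [_ _] := cdP j; apply.
Qed.

End FiniteToInfinite.

(** * From sequences to finite systems *)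

Section BlockSum.
Variables (R : realType) (V : nat -> lmodType R[i]).
Variable ip : forall k, V k -> V k -> R[i].
Hypothesis ipP : forall k, is_inner_product (@ip k).
Variables (n : nat -> nat) (m : forall k, 'I_(n k) -> R[i]).
Variables (x f : forall k, 'I_(n k) -> V k).
Arguments ip {k}.
Arguments m {k}.
Arguments x {k}.
Arguments f {k}.

Hypothesis xf_bound : forall k (y : V k) (eps : 'I_(n k) -> R[i]),
  (forall j, cabs (eps j) = 1) ->
  hnorm ip (\sum_(j < n k) (eps j * m j * ip y (f j)) *: x j) <= hnorm ip y.

Local Notation H := (l2 R predT).
Local Notation hip := (@l2ip R predT).

(* A sum over a subset is the average of two signed full sums. *)
Lemma xf_bound_subset k (y : V k) (eps : 'I_(n k) -> R[i]) (P : pred 'I_(n k)) :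
  (forall j, cabs (eps j) = 1) ->
  hnorm ip (\sum_(j < n k | P j) (eps j * m j * ip y (f j)) *: x j) <= hnorm ip y.
Proof.
move=> e1; pose eps' j := if P j then eps j else - eps j.
have e1' j : cabs (eps' j) = 1 by rewrite /eps'; case: (P j); rewrite ?cabsN.
have E : \sum_(j < n k) (eps j * m j * ip y (f j)) *: x j +
    \sum_(j < n k) (eps' j * m j * ip y (f j)) *: x j =
    2%:R *: \sum_(j < n k | P j) (eps j * m j * ip y (f j)) *: x j.
  rewrite -big_split /= [in RHS]big_mkcond scaler_sumr; apply: eq_bigr => j _.
  rewrite /eps'; case: (P j); first by rewrite scaler_nat mulr2n.
  by rewrite !mulNr scaleNr subrr scaler0.
have := hnormD (ipP k) (\sum_(j < n k) (eps j * m j * ip y (f j)) *: x j)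
  (\sum_(j < n k) (eps' j * m j * ip y (f j)) *: x j).
rewrite E hnormZ // (_ : cabs 2%:R = 2); last first.
  by rewrite -(rmorph_nat (real_complex R)) cabs_real normr_nat.
by have := xf_bound y e1; have := xf_bound y e1'; lra.
Qed.

Definition block_basis k := cid (gram_schmidt (ipP k)
  ([seq x j | j <- enum 'I_(n k)] ++ [seq f j | j <- enum 'I_(n k)])).

Definition block_dim k : nat := projT1 (block_basis k).

Definition block_vec k : nat -> V k := projT1 (cid (projT2 (block_basis k))).

Lemma block_vecP k : orthonormal ip (block_dim k) (block_vec k) /\
  forall v, v \in [seq x j | j <- enum 'I_(n k)] ++ [seq f j | j <- enum 'I_(n k)] ->
    oproj ip (block_dim k) (block_vec k) v = v.
Proof. by rewrite /block_vec; case: cid. Qed.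

Lemma block_oprojx k (j : 'I_(n k)) :
  oproj ip (block_dim k) (block_vec k) (x j) = x j.
Proof. by have [_] := block_vecP k; apply; rewrite mem_cat map_f // mem_enum. Qed.

Lemma block_oprojf k (j : 'I_(n k)) :
  oproj ip (block_dim k) (block_vec k) (f j) = f j.
Proof.
by have [_] := block_vecP k; apply; rewrite mem_cat orbC map_f // mem_enum.
Qed.

(** Coding the pair [(k, i)] as one coordinate gives different blocks disjoint supports, hence
    orthogonality. *)
Definition block_delta (k i : nat) : H := l2_delta R predT (pickle (k, i)).

Lemma block_deltaP k : orthonormal hip (block_dim k) (block_delta k).
Proof.
apply: (@l2_delta_orthonormal R predT _ (fun i => pickle (k, i))) => //.
by move=> i j /(pcan_inj pickleK)[].
Qed.

Definition embed k : V k -> H := transfer ip (block_dim k) (block_vec k) (block_delta k).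
Definition coembed k : H -> V k :=
  transfer hip (block_dim k) (block_delta k) (block_vec k).

Arguments embed : clear implicits.
Arguments coembed : clear implicits.

Lemma embed_le k v : hnorm hip (embed k v) <= hnorm ip v.
Proof.
apply: hnorm_transfer => //; first exact: l2ip_inner.
  by have [] := block_vecP k.
exact: block_deltaP.
Qed.

Lemma coembed_adj k y v : ip (coembed k y) v = hip y (embed k v).
Proof. by apply: transfer_adj => //; apply: l2ip_inner. Qed.

Lemma embed_ip k y v : oproj ip (block_dim k) (block_vec k) v = v ->
  hip (embed k y) (embed k v) = ip y v.
Proof.
by apply: transfer_ip => //; [exact: l2ip_inner|exact: block_deltaP].
Qed.

Lemma embed_ortho k l (v : V k) (w : V l) : k != l ->
  hip (embed k v) (embed l w) = 0.
Proof.
have hP := @l2ip_inner R predT.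
move=> kl; rewrite ip_suml // big1 // => i _; rewrite ip_sumr // big1 // => j _.
rewrite ipZl // ipZr // l2ip_delta //= (inj_eq (pcan_inj pickleK)) xpair_eqE.
by rewrite eq_sym (negPf kl) /= !mulr0.
Qed.

(** Duality: the left side [T] equals [<y, z>] with [z] the sum of the embedded components.
    Orthogonality of the blocks gives [|z|^2 <= T], and Cauchy-Schwarz yields [T^2 <= |y|^2 T]. *)
Lemma sqsum_coembed (y : H) (K : nat) :
  \sum_(k < K) hnorm ip (coembed k y) ^+ 2 <= hnorm hip y ^+ 2.
Proof.
have hP := @l2ip_inner R predT.
pose T := \sum_(k < K) hnorm ip (coembed k y) ^+ 2.
pose z := \sum_(k < K) embed k (coembed k y).
have T0 : 0 <= T by apply: sumr_ge0 => k _; apply: sqr_ge0.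
have zT : hnorm hip z ^+ 2 <= T.
  rewrite /z (hnorm_sqr_sum (F := fun k => embed k (coembed k y)) hP); last first.
    by move=> i j _ _; apply: embed_ortho.
  by apply: ler_sum => k _; rewrite ler_pXn2r ?nnegrE ?hnorm_ge0 // embed_le.
have : T <= hnorm hip y * hnorm hip z.
  apply: le_trans (cauchy_schwarz hP y z).
  rewrite ip_sumr // (_ : \sum_(k < K) _ = T%:C%C) ?cabs_real ?ler_norm //.
  by rewrite rmorph_sum; apply: eq_bigr => k _; rewrite -coembed_adj ipxx.
rewrite -/T => Tle; have [->|/eqP T1] := eqVneq T 0; first exact: sqr_ge0.
have {}T1 : 0 < T by rewrite lt_def T0 andbT; apply/eqP.
rewrite -(ler_pM2l T1); apply: (@le_trans _ _ ((hnorm hip y * hnorm hip z) ^+ 2)).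
  by rewrite -expr2 ler_pXn2r ?nnegrE ?mulr_ge0 ?hnorm_ge0.
by rewrite exprMn mulrC ler_wpM2r ?sqr_ge0.
Qed.

Definition code (k : nat) (i : 'I_(n k)) : nat := pickle (k, val i).

Lemma code_inj k : injective (@code k).
Proof. by move=> i j /(pcan_inj pickleK)[/val_inj]. Qed.

(** Strings the blocks into one sequence over [nat]; numbers that are no code receive the default
    [z], so with [z = 0] they add nothing to the series. *)
Definition decode (T : Type) (F : forall k, 'I_(n k) -> T) (z : T) (j : nat) : T :=
  if pickle_inv j is Some (k, i) then oapp (F k) z (insub i) else z.

Lemma codeK (T : Type) (F : forall k, 'I_(n k) -> T) z k i :
  decode F z (@code k i) = F k i.
Proof. by rewrite /decode pickleK_inv valK. Qed.

(** At most one pair [(k, i)] has code [j]. The double sum allows summation over [j] to be exchanged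
    with summation over blocks. *)
Lemma decode_sum (T : nmodType) (F : forall k, 'I_(n k) -> T) (j K : nat) :
  (forall k i, @code k i = j -> (k < K)%N) ->
  decode F 0 j = \sum_(k < K) \sum_(i < n k | code i == j) F k i.
Proof.
move=> jK; rewrite /decode.
have noF : (forall k i, @code k i != j) ->
    0 = \sum_(k < K) \sum_(i < n k | code i == j) F k i.
  move=> nj; rewrite big1 // => k _; rewrite big_pred0 // => i.
  by apply: negPf; apply: nj.
case E : pickle_inv => [[k i]|]; last first.
  by apply: noF => k i; apply/eqP => cj; rewrite -cj pickleK_inv in E.
have ji : pickle (k, i) = j by have := @pickle_invK (nat * nat)%type j; rewrite E.
case: insubP => [i' _ i'E|ni] /=; last first.
  apply: noF => l i'; apply/eqP; rewrite -ji => /(pcan_inj pickleK)[lk i'i].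
  by move: ni; rewrite -lk -i'i ltn_ord.
have ci : code i' = j by rewrite /code i'E.
rewrite (bigD1 (Ordinal (jK _ _ ci))) //= [X in _ + X]big1 => [|l lk].
  rewrite addr0 (bigD1 i') ?ci //= big_pred0 ?addr0 // => i1.
  by apply/andP => -[/eqP c1 /eqP]; apply; apply: code_inj; rewrite c1.
rewrite big_pred0 // => i1; apply/eqP; rewrite -ci => /(pcan_inj pickleK)[lk' _].
by move/eqP: lk; apply; apply: val_inj.
Qed.

(** The coding does not list the blocks one after the other; this bound and [code_bound] compare
    initial segments of indices with initial families of blocks. *)
Lemma code_block_bound (N : nat) :
  exists K, forall k i, (@code k i < N)%N -> (k < K)%N.
Proof.
pose F (j : nat) := (oapp fst 0 (pickle_inv j : option (nat * nat))).+1.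
exists (\max_(j < N) F j) => k i cN.
have := leq_bigmax (F := fun j : 'I_N => F j) (Ordinal cN).
by rewrite /F /= pickleK_inv.
Qed.

Lemma code_bound (K : nat) :
  exists N, forall k i, (k < K)%N -> (@code k i < N)%N.
Proof.
exists (\max_(k < K) \max_(i < n k) (code i).+1) => k i kK.
have := leq_bigmax (F := fun k : 'I_K => \max_(i < n k) (code i).+1) (Ordinal kK).
apply: leq_trans.
exact: (leq_bigmax (F := fun i : 'I_(n k) => (code i).+1) i).
Qed.

Definition block_m := decode (@m) 0.
Definition block_x := decode (fun k i => embed k (x i)) 0.
Definition block_f := decode (fun k i => embed k (f i)) 0.

Lemma block_term (y : H) (eps : nat -> R[i]) j :
  (eps j * block_m j * hip y (block_f j)) *: block_x j =
  decode (fun k i =>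
    embed k ((eps (code i) * m i * ip (coembed k y) (f i)) *: x i)) 0 j.
Proof.
have Z k a (v : V k) : embed k (a *: v) = a *: embed k v.
  have := transfer_sum (ipP k) (block_dim k) (block_vec k) (block_delta k)
    [:: tt] xpredT (fun=> a) (fun=> v).
  by rewrite !big_seq1.
rewrite /block_m /block_f /block_x /decode.
case E : pickle_inv => [[k i]|]; last by rewrite scaler0.
case: insubP => [i' _ i'E|] /=; last by rewrite scaler0.
rewrite Z coembed_adj; congr (((eps _ * _) * _) *: _).
by have := @pickle_invK (nat * nat)%type j; rewrite E /code i'E.
Qed.

(** A range of indices cuts each block in some subset, to which the subset bound applies.
    Orthogonality adds the squares, and blocks before [K0] are over by index [a]. *)
Lemma block_sum_le (y : H) (eps : nat -> R[i]) (K0 M0 a b : nat) (e : R) :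
  (forall j, cabs (eps j) = 1) ->
  (forall k i, (k < K0)%N -> (@code k i < M0)%N) -> (M0 <= a)%N ->
  (forall K, (K0 <= K)%N -> \sum_(K0 <= k < K) hnorm ip (coembed k y) ^+ 2 <= e) ->
  hnorm hip (\sum_(a <= j < b) (eps j * block_m j * hip y (block_f j)) *: block_x j) ^+ 2
    <= e.
Proof.
move=> e1 KM Ma tail.
have [K1 bK1] := code_block_bound b.
(* [K1] captures every block with an index below [b]; the maximum makes the tail hypothesis
   available. *)
pose K := maxn K0 K1.
have bK k i : (@code k i < b)%N -> (k < K)%N.
  by move=> /bK1 kK; rewrite leq_max kK orbT.
pose w k (i : 'I_(n k)) := (eps (code i) * m i * ip (coembed k y) (f i)) *: x i.
pose S k := embed k (\sum_(i < n k | (a <= code i < b)%N) w k i).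
have -> : \sum_(a <= j < b) (eps j * block_m j * hip y (block_f j)) *: block_x j =
    \sum_(k < K) S k.
  under eq_bigr do rewrite block_term.
  rewrite (eq_big_nat _ _ (F2 := fun j => \sum_(k < K)
      \sum_(i < n k | code i == j) embed k (w k i))); last first.
    move=> j /andP[_ jb]; apply: decode_sum => k i cj; apply: (bK k i).
    by rewrite cj.
  rewrite exchange_big; apply: eq_bigr => k _ /=.
  have D : {morph embed k : u v / u + v >-> u + v}.
    move=> u v; have := transfer_sum (ipP k) (block_dim k) (block_vec k)
      (block_delta k) [:: u; v] xpredT (fun=> 1) id.
    by rewrite !big_cons !big_nil !addr0 !scale1r.
  have Z : embed k 0 = 0.
    by apply: (addrI (embed k 0)); rewrite -D !addr0.
  rewrite /S (big_morph _ D Z) /=.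
  under eq_bigr do rewrite big_mkcond.
  rewrite exchange_big [RHS]big_mkcond; apply: eq_bigr => i _ /=.
  rewrite -big_mkcond /= (eq_bigl (fun j => j == code i)); last first.
    by move=> j; rewrite eq_sym.
  by rewrite big_nat1_eq.
rewrite (hnorm_sqr_sum (F := S) (@l2ip_inner R predT)); last first.
  by move=> i j _ _; apply: embed_ortho.
apply: le_trans (tail K (leq_maxl _ _)).
rewrite -(big_mkord xpredT (fun k => hnorm hip (S k) ^+ 2)).
rewrite (big_cat_nat (n := K0)) ?leq_maxl //= big1_seq ?add0r.
  apply: ler_sum => k _; rewrite ler_pXn2r ?nnegrE ?hnorm_ge0 //.
  apply: (le_trans (embed_le _)).
  exact: (xf_bound_subset (coembed k y) (fun i => a <= code i < b)%N
    (fun i => e1 (code i))).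
move=> k /andP[_]; rewrite mem_index_iota => /andP[_ kK].
have -> : S k = 0.
  rewrite /S big_pred0 => [|i]; first by apply: big1 => i _; rewrite ip0l // scale0r.
  by apply/andP => -[ai _]; have := KM k i kK; rewrite ltnNge (leq_trans Ma ai).
by rewrite hnorm0 ?expr0n //; exact: l2ip_inner.
Qed.

Lemma block_series (y : H) (eps : nat -> R[i]) : (forall j, cabs (eps j) = 1) ->
  hseries_converges hip (fun j => (eps j * block_m j * hip y (block_f j)) *: block_x j).
Proof.
move=> e1; apply: l2_complete => e e0.
(* The component norms are viewed as a complex sequence, so that convergence of their squares
   follows from [sqsum_cvg]. *)
pose a k := (hnorm ip (coembed k y))%:C%C : R[i].
have aE K : sqsum a K = \sum_(k < K) hnorm ip (coembed k y) ^+ 2.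
  by apply: eq_bigr => k _; rewrite cabs_real ger0_norm // hnorm_ge0.
have sa : sqsummable a.
  by exists (hnorm hip y ^+ 2) => K; rewrite aE sqsum_coembed.
have e2 : 0 < (e / 2) ^+ 2 by rewrite exprn_gt0 // divr_gt0.
have := sqsum_cvg sa; move=> /cvgrPdist_lt-/(_ _ e2)[K0 _ /(_ K0 (leqnn K0)) /= aK].
have [M0 KM] := code_bound K0.
have tail K : (K0 <= K)%N ->
    \sum_(K0 <= k < K) hnorm ip (coembed k y) ^+ 2 <= (e / 2) ^+ 2.
  move=> KK; have := nondecreasing_cvgn_le (@sqsum_nd _ a) (sqsum_cvg sa) K.
  rewrite aE -(big_mkord xpredT (fun k => hnorm ip (coembed k y) ^+ 2)).
  rewrite (big_cat_nat (n := K0)) //= big_mkord -aE.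
  by move: aK; rewrite ltr_norml => /andP[_ aK]; lra.
pose u j := (eps j * block_m j * hip y (block_f j)) *: block_x j.
have main p q : (M0 <= p)%N -> (p <= q)%N ->
    hnorm hip (\sum_(j < q) u j - \sum_(j < p) u j) < e.
  move=> Mp pq; rewrite -!(big_mkord xpredT u) (@big_cat_nat _ _ _ p 0 q) //=.
  rewrite [X in hnorm _ X]addrC addKr; apply: (@le_lt_trans _ _ (e / 2)); last by lra.
  rewrite -(ler_pXn2r (n := 2)) ?nnegrE ?hnorm_ge0 //; last by lra.
  exact: block_sum_le e1 KM Mp tail.
exists M0 => p q Mp Mq; have [pq|/ltnW qp] := leqP p q; last exact: main.
by rewrite hnormC; [exact: main|exact: l2ip_inner].
Qed.

(** Test the bound at an embedded vector and keep only the terms whose index codes block [k]; the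
    discarded terms are nonnegative. *)
Lemma block_bessel (B : R) (c : nat -> R[i]) (z : forall k, 'I_(n k) -> V k) :
  0 <= B ->
  (forall k i, oproj ip (block_dim k) (block_vec k) (z k i) = z k i) ->
  has_bessel_bound hip B (fun j => c j *: decode (fun k i => embed k (z k i)) 0 j) ->
  forall k, has_bessel_bound_fin ip B (fun i : 'I_(n k) => c (code i) *: z k i).
Proof.
move=> B0 pz cB k y; have hP := @l2ip_inner R predT.
apply: (@le_trans _ _ (B * hnorm hip (embed k y) ^+ 2)); last first.
  apply: ler_wpM2l => //.
  by rewrite ler_pXn2r ?nnegrE ?hnorm_ge0 // embed_le.
have [N kN] := code_bound k.+1.
have iN i : (@code k i < N)%N by apply: kN.
apply: le_trans (cB (embed k y) N).
pose G j := cabs (hip (embed k y) (c j *: decode (fun k i => embed k (z k i)) 0 j)) ^+ 2.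
pose h i := Ordinal (iN i).
have hI : injective h by move=> i j /(congr1 val) /code_inj.
rewrite (_ : \sum_(j < n k) _ = \sum_(j in h @: [set: 'I_(n k)]%SET) G j).
  rewrite [leRHS](bigID (mem (h @: [set: 'I_(n k)]%SET))) /= lerDl.
  by apply: sumr_ge0 => j _; apply: sqr_ge0.
rewrite big_imset /=; last by move=> i j _ _; apply: hI.
apply: eq_big => [i|i _]; first by rewrite inE.
by rewrite /G /h /= codeK !ipZr // embed_ip.
Qed.

Lemma block_factorization :
  (forall (mu : nat -> R[i]) (xi phi : nat -> H),
     (forall (y : H) (eps : nat -> R[i]), (forall j, cabs (eps j) = 1) ->
        hseries_converges hip (fun j => (eps j * mu j * hip y (phi j)) *: xi j)) ->
     exists c d : nat -> R[i],
       (forall j, c j * conjc (d j) = mu j) /\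
       is_bessel hip (fun j => c j *: xi j) /\
       is_bessel hip (fun j => d j *: phi j)) ->
  exists B : R, forall k, exists c d : 'I_(n k) -> R[i],
    (forall j, c j * conjc (d j) = m j) /\
    has_bessel_bound_fin ip B (fun j => c j *: x j) /\
    has_bessel_bound_fin ip B (fun j => d j *: f j).
Proof.
move=> /(_ block_m block_x block_f block_series)[c [d [cd [[B1 cB] [B2 dB]]]]].
(* A common bound for both sequences, made nonnegative as [block_bessel] requires. *)
pose B := `|B1| + `|B2|.
have B0 : 0 <= B by rewrite addr_ge0.
have widen B' (z : nat -> H) : B' <= B -> has_bessel_bound hip B' z ->
    has_bessel_bound hip B z.
  move=> BB zB y N; apply: (le_trans (zB y N)).
  by apply: ler_wpM2r => //; apply: sqr_ge0.
have BB1 : B1 <= B by apply: (le_trans (ler_norm _)); rewrite lerDl.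
have BB2 : B2 <= B by apply: (le_trans (ler_norm _)); rewrite lerDr.
exists B => k; exists (fun i => c (code i)), (fun i => d (code i)); split; last split.
- by move=> i; rewrite cd /block_m codeK.
- exact: (block_bessel B0 block_oprojx (widen _ _ BB1 cB)).
- exact: (block_bessel B0 block_oprojf (widen _ _ BB2 dB)).
Qed.

End BlockSum.

(** Bundling the space with its data lets choice select a whole counterexample for each [k]. *)
Record finite_system (R : realType) := FiniteSystem {
  sys_space : lmodType R[i];
  sys_ip : sys_space -> sys_space -> R[i];
  sys_size : nat;
  sys_m : 'I_sys_size -> R[i];
  sys_x : 'I_sys_size -> sys_space;
  sys_f : 'I_sys_size -> sys_space }.
Arguments sys_ip {R} _.
Arguments sys_m {R} _.
Arguments sys_x {R} _.
Arguments sys_f {R} _.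

Definition sys_bounded (R : realType) (s : finite_system R) (C : R) :=
  forall (y : sys_space s) (eps : 'I_(sys_size s) -> R[i]),
    (forall j, cabs (eps j) = 1) ->
    hnorm (sys_ip s)
      (\sum_j (eps j * sys_m s j * sys_ip s y (sys_f s j)) *: sys_x s j)
    <= C * hnorm (sys_ip s) y.

Definition sys_factored (R : realType) (s : finite_system R) (B : R) :=
  exists c d : 'I_(sys_size s) -> R[i],
    (forall j, c j * conjc (d j) = sys_m s j) /\
    has_bessel_bound_fin (sys_ip s) B (fun j => c j *: sys_x s j) /\
    has_bessel_bound_fin (sys_ip s) B (fun j => d j *: sys_f s j).

Definition sys_scale (R : realType) (s : finite_system R) (r : R) :=
  @FiniteSystem R (sys_space s) (sys_ip s) (sys_size s)
    (fun j => r%:C%C * sys_m s j) (sys_x s) (sys_f s).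

(** * Normalising the constant of a finite system *)

Section Scaling.
Variables (R : realType) (s : finite_system R).
Hypothesis ipP : is_inner_product (sys_ip s).

Lemma sys_bounded_scale (C : R) : 0 < C -> sys_bounded s C ->
  sys_bounded (sys_scale s C^-1) 1.
Proof.
move=> C0 sC y eps e1; rewrite mul1r /=.
rewrite (_ : \sum_j _ = (C^-1)%:C%C *:
  \sum_j (eps j * sys_m s j * sys_ip s y (sys_f s j)) *: sys_x s j).
  rewrite hnormZ // cabs_real gtr0_norm ?invr_gt0 // ler_pdivrMl //.
  exact: sC.
rewrite scaler_sumr; apply: eq_bigr => j _; rewrite scalerA; congr (_ *: _).
by ring.
Qed.

(** Both [c] and [d] are multiplied by the square root of [C]: the product gains [C], and so does
    each Bessel bound. *)
Lemma sys_factored_scale (C B : R) : 0 < C ->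
  sys_factored (sys_scale s C^-1) B -> sys_factored s (C * B).
Proof.
move=> C0 [c [d [cd [cx df]]]]; rewrite /= in c d cd cx df.
pose r := (Num.sqrt C)%:C%C : R[i].
have rr : r * r = C%:C%C by rewrite -rmorphM /= -expr2 sqr_sqrtr ?ltW.
have rB (b : 'I_(sys_size s) -> R[i]) (z : 'I_(sys_size s) -> sys_space s) :
    has_bessel_bound_fin (sys_ip s) B (fun j => b j *: z j) ->
    has_bessel_bound_fin (sys_ip s) (C * B) (fun j => (r * b j) *: z j).
  move=> bz y; rewrite -mulrA; apply: (@le_trans _ _ (C *
    \sum_j cabs (sys_ip s y (b j *: z j)) ^+ 2)); last by rewrite ler_pM2l // bz.
  rewrite mulr_sumr; apply: ler_sum => j _.
  rewrite -scalerA (ipZr ipP) cabsM cabs_conj cabs_real exprMn real_normK ?num_real //.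
  by rewrite sqr_sqrtr // ltW.
exists (fun j => r * c j), (fun j => r * d j); split=> [j|].
  rewrite rmorphM /= -[X in _ * (X * _)]/(conjc r) conjc_real mulrACA rr cd.
  by rewrite mulrA -rmorphM /= mulfV ?gt_eqF // mul1r.
by split; apply: rB.
Qed.

End Scaling.

Theorem theorem2p1 (R : realType) :
  (* (1) *)
  (forall (V : lmodType R[i]) (ip : V -> V -> R[i]),
     is_hilbert ip -> hseparable ip ->
     forall (m : nat -> R[i]) (x f : nat -> V),
       (forall (y : V) (eps : nat -> R[i]), (forall j, cabs (eps j) = 1) ->
          hseries_converges ip (fun j => (eps j * m j * ip y (f j)) *: x j)) ->
       exists c d : nat -> R[i],
         (forall j, c j * conjc (d j) = m j) /\
         is_bessel ip (fun j => c j *: x j) /\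
         is_bessel ip (fun j => d j *: f j))
  <->
  (* (2) *)
  (exists kappa : R, 0 < kappa /\
   forall (Cst : R), 0 < Cst ->
   forall (V : lmodType R[i]) (ip : V -> V -> R[i]),
     is_hilbert ip -> hfinite_dim V ->
     forall (n : nat) (m : 'I_n -> R[i]) (x f : 'I_n -> V),
       (forall (y : V) (eps : 'I_n -> R[i]), (forall j, cabs (eps j) = 1) ->
          hnorm ip (\sum_(j < n) (eps j * m j * ip y (f j)) *: x j)
            <= Cst * hnorm ip y) ->
       exists c d : 'I_n -> R[i],
         (forall j, c j * conjc (d j) = m j) /\
         has_bessel_bound_fin ip (Cst * kappa) (fun j => c j *: x j) /\
         has_bessel_bound_fin ip (Cst * kappa) (fun j => d j *: f j)).
Proof.
split=> [inf|[kappa [k0 fin]] V ip [ipP complete] _ m x f]; last first.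
  exact: (finite_to_infinite ipP complete k0 fin).
apply: contrapT => nfin.
have bad (k : nat) : exists p : finite_system R * R,
    [/\ 0 < p.2, is_inner_product (sys_ip p.1), sys_bounded p.1 p.2
      & ~ sys_factored p.1 (p.2 * k.+1%:R)].
  (* The candidate constant is [k + 1], positive also for [k = 0]. *)
  apply: contrapT => nbad; apply: nfin; exists k.+1%:R; split=> [|C C0].
    by rewrite ltr0n.
  move=> V ip [ipP _] _ n m x f xf; apply: contrapT => nf; apply: nbad.
  by exists (@FiniteSystem R V ip n m x f, C).
have {bad} [p pP] := choice bad.
pose s k := sys_scale (p k).1 (p k).2^-1.
have ipP k : is_inner_product (sys_ip (s k)) by have [] := pP k.
have sB k : sys_bounded (s k) 1.
  by have [C0 iP sC _] := pP k; apply: sys_bounded_scale.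
have [||B BP] := @block_factorization R (fun k => sys_space (s k))
    (fun k => sys_ip (s k)) ipP (fun k => sys_size (s k)) (fun k => sys_m (s k))
    (fun k => sys_x (s k)) (fun k => sys_f (s k)).
- by move=> k y eps e1; have := sB k y eps e1; rewrite mul1r.
- by apply: inf; [exact: l2_hilbert|exact: l2_separable].
(* This block has [B <= k + 1], so undoing its normalisation gives the factorization it was chosen
   to lack. *)
pose k := Num.bound `|B|.
have [C0 iP _] := pP k; apply.
have [c [d [cd [cx df]]]] : sys_factored (p k).1 ((p k).2 * B).
  exact: sys_factored_scale (BP k).
have Bk : B <= k.+1%:R.
  apply: (le_trans (ler_norm _)); apply: (le_trans (ltW (archi_boundP _))) => //.
  by rewrite ler_nat leqnSn.
have widen z : has_bessel_bound_fin (sys_ip (p k).1) ((p k).2 * B) z ->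
    has_bessel_bound_fin (sys_ip (p k).1) ((p k).2 * k.+1%:R) z.
  move=> zB y; apply: (le_trans (zB y)); apply: ler_wpM2r; first exact: sqr_ge0.
  by rewrite ler_pM2l.
by exists c, d; split=> //; split; apply: widen.
Qed.
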